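(* Up to rescaling, the strong $0$th order sequences are exactly the sequence of ladders and the sequences $Z_n(b)$. That is: a sequence $(t_k)_{k\ge1}\in\mathcal{S}eq$ is a strong $0$th order sequence if and only if there is $c\in\mathbb{K}\setminus\{0\}$ such that either $t_k=c^{k-1}\ell_k$ for all $k\ge 1$, or there exist $n\ge 1$ and $b\in\mathbb{K}\setminus\{0\}$ such that $t_k=c^{k-1}z_k$ for all $k\ge1$, where $z_k$ is the homogeneous component of degree $k$ of $$Z_n(b)=B_+\left(\exp\left(\sum_{k=1}^{n-1}p_k+b\,p_n\right)\right).$$
   Context: $\mathbb{K}$ is a field of characteristic zero. $H_{CK}$ is the Connes-Kreimer Hopf algebra of rooted trees over $\mathbb{K}$: the polynomial algebra on the set of nonempty (non-planar) rooted trees, monomials being identified with forests (product = disjoint union), unit $1$ = empty forest, graded by the number of vertices. The coproduct is the algebra morphism given on a tree $t$ by $\Delta(t)=t\otimes 1+1\otimes t+\sum_c P^c(t)\otimes R^c(t)$, where $c$ runs over non-empty admissible cuts (non-empty sets of edges containing at most one edge of any path from the root to a leaf), $R^c(t)$ is the component containing the root after removing the edges of $c$, and $P^c(t)$ is the forest of the other components. $\bullet$ is the one-vertex tree. $B_+$ is the linear map sending a forest $s_1\cdots s_k$ to the tree obtained by adding a new root whose children are the roots of $s_1,\ldots,s_k$; it is extended to the graded completion of $H_{CK}$. $\mathcal{S}eq$ is the set of sequences $(t_n)_{n\ge1}$ in $H_{CK}$ such that each $t_n$ is a nonzero linear combination of trees with $n$ vertices, $t_1=\bullet$, and the subalgebra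 generated by the $t_n$ is a Hopf subalgebra of $H_{CK}$. The $\Lambda$-array of $(t_n)\in\mathcal{S}eq$ is $(\lambda_{i,j})_{i,j\ge1}$, where $\lambda_{i,j}$ is the coefficient of $t_j\otimes t_i$ in $\Delta(t_{i+j})$ (in the basis of tensors of monomials in the $t_n$). A sequence $(u_i)_{i\ge1}$ in $\mathbb{K}$ has order $k$ (resp. at most $k$) if $u_i$ is given by a polynomial in $i$ of degree exactly $k$ (resp. at most $k$, the zero polynomial being allowed). The sequence $(t_n)\in\mathcal{S}eq$ is a strong $k$th order sequence if for every $j\ge1$ the sequence $(\lambda_{i,j})_{i\ge1}$ has order at most $k$, and $(\lambda_{i,1})_{i\ge1}$ has order exactly $k$. $\ell_n$ is the ladder with $n$ vertices (a single path rooted at one end), and $p_n=\sum_{k=1}^n\ \sum_{j_1+\cdots+j_k=n,\ j_1,\ldots,j_k\ge1}\frac{(-1)^{k+1}}{k}\,\ell_{j_1}\cdots\ell_{j_k}$, where the products are taken in $H_{CK}$. *)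

(* Defs.v *)
From HB Require Import structures.
From mathcomp Require Import all_boot all_order all_algebra.
From mathcomp Require Import finmap monalg.

Set Implicit Arguments.
Unset Strict Implicit.
Unset Printing Implicit Defensive.

Import GRing.Theory.

(** * Rooted trees *)

Inductive ptree : Type := PNode of seq ptree.

Definition children (t : ptree) : seq ptree := let: PNode s := t in s.

Lemma ptree_nested_ind (P : ptree -> Prop) :
  (forall s, (forall i, i < size s -> P (nth (PNode [::]) s i)) -> P (PNode s)) ->
  forall t, P t.
Proof.
move=> HP; fix IH 1; case=> s; apply: HP.
elim: s => [|u s IHs] i; first discriminate.
case: i => [_ | i lti]; [exact: (IH u) | exact: IHs].
Qed.

Fixpoint ptree_encode (t : ptree) : GenTree.tree void :=
  let: PNode s := t in GenTree.Node 0 (map ptree_encode s).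

Fixpoint ptree_decode (g : GenTree.tree void) : ptree :=
  if g is GenTree.Node _ s then PNode (map ptree_decode s) else PNode [::].

Lemma ptree_encodeK : cancel ptree_encode ptree_decode.
Proof.
elim/ptree_nested_ind=> s IH /=; congr PNode; rewrite -map_comp.
apply: (@eq_from_nth _ (PNode [::])) => [|i]; rewrite size_map // => lti.
by rewrite (nth_map (PNode [::])) //= IH.
Qed.

HB.instance Definition _ := Countable.copy ptree (can_type ptree_encodeK).

(* An arbitrary total order, used only to pick one planar representative of
   each non-planar tree; locked, since these unary codes are far too large to
   be evaluated. *)
Definition ptree_le : rel ptree :=
  locked (fun t u => choice.pickle t <= choice.pickle u).

Fixpoint canonical (t : ptree) : bool :=
  let: PNode s := t in sorted ptree_le s && all id (map canonical s).

Fixpoint canon (t : ptree) : ptree :=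
  let: PNode s := t in PNode (sort ptree_le (map canon s)).

Lemma canon_canonical t : canonical (canon t).
Proof.
elim/ptree_nested_ind: t => s IH /=; apply/andP; split.
  by apply: sort_sorted => t u; rewrite /ptree_le -lock leq_total.
rewrite all_map all_sort all_map; apply/(all_nthP (PNode [::])) => i lti.
exact: IH.
Qed.

(* Isomorphism classes of rooted trees: planar trees modulo permuting the
   children of every vertex, each class being represented by its unique member
   whose lists of children are all sorted. *)
Record rtree : Type := RTree { rtree_val : ptree; _ : canonical rtree_val }.

HB.instance Definition _ := [isSub for rtree_val].
HB.instance Definition _ := [Countable of rtree by <:].

Definition rtree_of (t : ptree) : rtree := RTree (canon_canonical t).

Fixpoint ptree_size (t : ptree) : nat :=
  let: PNode s := t in (sumn (map ptree_size s)).+1.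

Definition tree_size (t : rtree) : nat := ptree_size (val t).

Definition ladder_tree (n : nat) : rtree :=
  rtree_of (iter n.-1 (fun u => PNode [:: u]) (PNode [::])).

(** * Admissible cuts *)

(* A vertex is the list of child positions met on the way from the root; an
   edge is identified with its lower endpoint, i.e. with a non-root vertex. *)
Fixpoint vertices (t : ptree) : seq (seq nat) :=
  let: PNode s := t in
  [::] :: flatten [seq map (cons p.1) p.2
                     | p <- zip (iota 0 (size s)) (map vertices s)].

Definition subtree (t : ptree) (v : seq nat) : ptree :=
  foldl (fun u i => nth (PNode [::]) (children u) i) t v.

Definition edges (t : ptree) : seq (seq nat) :=
  [seq v <- vertices t | v != [::]].

Definition leaves (t : ptree) : seq (seq nat) :=
  [seq v <- vertices t | children (subtree t v) == [::]].

Definition cut (t : ptree) : predArgType := {set seq_sub (edges t)}.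

(* The edges on the path from the root to [l] are the non-empty prefixes
   of [l]. *)
Definition admissible (t : ptree) (c : cut t) : bool :=
  all (fun l => #|[set e in c | prefix (val e) l]| <= 1) (leaves t).

(* The component of the root once the edges satisfying [c] are removed. *)
Fixpoint root_component (t : ptree) (c : pred (seq nat)) : ptree :=
  let: PNode s := t in
  PNode [seq p.2 (fun v => c (p.1 :: v))
           | p <- zip (iota 0 (size s)) (map root_component s) & ~~ c [:: p.1]].

Definition in_cut (t : ptree) (c : cut t) (v : seq nat) : bool :=
  v \in [seq val e | e in c].

(* The component whose topmost vertex is [v], for [v] the root or the lower
   endpoint of a removed edge. *)
Definition component (t : ptree) (c : cut t) (v : seq nat) : ptree :=
  root_component (subtree t v) (fun w => in_cut c (v ++ w)).

Notation forest := {cmonom rtree}.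

Definition trunk (t : ptree) (c : cut t) : rtree := rtree_of (component c [::]).

Definition pruned (t : ptree) (c : cut t) : forest :=
  (\big[mmul/mone]_(e in c) ucm (rtree_of (component c (val e))))%M.

(** * The Connes-Kreimer Hopf algebra *)

Section PairMonomials.
Variables M N : monomType.

Definition pair_one : M * N := (mone, mone).
Definition pair_mul (x y : M * N) : M * N := (mmul x.1 y.1, mmul x.2 y.2).

Fact pair_mulA : associative pair_mul.
Proof. by move=> x y z; rewrite /pair_mul /= !mulmA. Qed.

Fact pair_mul1m : left_id pair_one pair_mul.
Proof. by case=> x y; rewrite /pair_mul /= !mul1m. Qed.

Fact pair_mulm1 : right_id pair_one pair_mul.
Proof. by case=> x y; rewrite /pair_mul /= !mulm1. Qed.

Fact pair_unitm x y :
  pair_mul x y = pair_one -> x = pair_one /\ y = pair_one.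
Proof.
by case: x y => [x1 x2] [y1 y2] [] /unitm [-> ->] /unitm [-> ->].
Qed.

HB.instance Definition _ := Choice_isMonomialDef.Build (M * N)%type
  pair_mulA pair_mul1m pair_mulm1 pair_unitm.
End PairMonomials.

Section PairCommutative.
Variables M N : conomType.

Fact pair_mulC : commutative (@mmul (M * N)%type).
Proof.
by case=> x1 x2 [y1 y2]; congr pair; apply: mulmC.
Qed.

HB.instance Definition _ :=
  MonomialDef_isConomialDef.Build (M * N)%type pair_mulC.
End PairCommutative.

Notation HCK K := {malg K[forest]}.

(* The tensor square, on the basis of pairs of forests: the pair (f, g)
   stands for the tensor of f and g. *)
Notation HCK2 K := {malg K[(forest * forest)%type]}.

Local Open Scope ring_scope.

Section HopfAlgebra.
Variable K : fieldType.

Definition tree (t : rtree) : HCK K := << ucm t >>.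

Definition tens (x y : HCK K) : HCK2 K :=
  \sum_(f <- msupp x) \sum_(g <- msupp y) << x@_f * y@_g *g (f, g) >>.

Definition coproduct_tree (t : rtree) : HCK2 K :=
  << (ucm t, mone) >> + << (mone, ucm t) >>
  + \sum_(c : cut (val t) | (c != set0) && admissible c)
      << (pruned c, ucm (trunk c)) >>.

Definition coproduct_forest (f : forest) : HCK2 K :=
  \prod_(t <- finsupp (cmonom_val f)) coproduct_tree t ^+ f t.

Definition coproduct (x : HCK K) : HCK2 K :=
  \sum_(f <- msupp x) x@_f *: coproduct_forest f.

Definition counit (x : HCK K) : K := x@_mone.

Definition is_antipode (S : {linear HCK K -> HCK K}) : Prop :=
  forall x : HCK K, let D := coproduct x in
    \sum_(p <- msupp D) D@_p *: (S << p.1 >> * << p.2 >>) = (counit x)%:A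
    /\ \sum_(p <- msupp D) D@_p *: (<< p.1 >> * S << p.2 >>) = (counit x)%:A.

(** * Hopf subalgebras *)

Definition is_subalgebra (A : HCK K -> Prop) : Prop :=
  [/\ A 1, forall (a : K) x y, A x -> A y -> A (a *: x + y)
    & forall x y, A x -> A y -> A (x * y)].

Definition in_tensor_square (A : HCK K -> Prop) (z : HCK2 K) : Prop :=
  exists s : seq (HCK K * HCK K),
    (forall p, p \in s -> A p.1 /\ A p.2) /\ z = \sum_(p <- s) tens p.1 p.2.

(* The antipode is determined by its axioms, so the universal quantifier
   ranges over a single map. *)
Definition is_Hopf_subalgebra (A : HCK K -> Prop) : Prop :=
  [/\ is_subalgebra A,
      forall x, A x -> in_tensor_square A (coproduct x)
    & forall S, is_antipode S -> forall x, A x -> A (S x)].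

(** * Sequences; the value at index 0 is never used *)

Definition generated (t : nat -> HCK K) (x : HCK K) : Prop :=
  forall A, is_subalgebra A -> (forall n, (0 < n)%N -> A (t n)) -> A x.

Definition tree_combination (n : nat) (x : HCK K) : Prop :=
  forall f : forest, f \in msupp x ->
    exists t : rtree, f = ucm t /\ tree_size t = n.

Definition in_Seq (t : nat -> HCK K) : Prop :=
  [/\ forall n, (0 < n)%N -> t n != 0 /\ tree_combination n (t n),
      t 1%N = tree (rtree_of (PNode [::]))
    & is_Hopf_subalgebra (generated t)].

(* The variable of index n stands for t_(n+1), so that t_0 does not occur. *)
Definition seq_monomial (t : nat -> HCK K) (m : {cmonom nat}) : HCK K :=
  \prod_(n <- finsupp (cmonom_val m)) t n.+1 ^+ m n.

Definition seq_tensor (t : nat -> HCK K)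
    (P : {malg K[({cmonom nat} * {cmonom nat})%type]}) : HCK2 K :=
  \sum_(p <- msupp P) P@_p *: tens (seq_monomial t p.1) (seq_monomial t p.2).

(* For t in Seq the monomials in the t_n are linearly independent, so that the
   expansion P exists and is unique. *)
Definition is_Lambda_array (t : nat -> HCK K) (lambda : nat -> nat -> K) : Prop :=
  forall i j, (0 < i)%N -> (0 < j)%N ->
    exists P, coproduct (t (i + j)%N) = seq_tensor t P
      /\ lambda i j = P@_(ucm j.-1, ucm i.-1).

Definition has_order (k : nat) (u : nat -> K) : Prop :=
  exists p : {poly K}, size p = k.+1 /\ forall i, (0 < i)%N -> u i = p.[i%:R].

Definition has_order_at_most (k : nat) (u : nat -> K) : Prop :=
  exists p : {poly K},
    (size p <= k.+1)%N /\ forall i, (0 < i)%N -> u i = p.[i%:R].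

Definition is_strong_order (k : nat) (t : nat -> HCK K) : Prop :=
  in_Seq t /\ exists lambda, [/\ is_Lambda_array t lambda,
    forall j, (0 < j)%N -> has_order_at_most k (fun i => lambda i j)
    & has_order k (fun i => lambda i 1%N)].

(** * Ladders and the sequences Z_n(b) *)

Definition ladder (n : nat) : HCK K := tree (ladder_tree n).

(* The compositions of n with k parts are the functions from 'I_k to
   {0, ..., n} with positive values that sum to n. *)
Definition p_ (n : nat) : HCK K :=
  \sum_(1 <= k < n.+1)
    \sum_(j : {ffun 'I_k -> 'I_n.+1} |
            [forall a, (0 < j a)%N] && ((\sum_a j a)%N == n))
      ((-1) ^+ k.+1 / k%:R) *: \prod_a ladder (j a).

Definition graft (f : forest) : rtree :=
  rtree_of (PNode (flatten [seq nseq (f t) (val t)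
                              | t <- finsupp (cmonom_val f)])).

Definition Bplus (x : HCK K) : HCK K :=
  \sum_(f <- msupp x) x@_f *: tree (graft f).

Definition forest_size (f : forest) : nat :=
  (\sum_(t <- finsupp (cmonom_val f)) f t * tree_size t)%N.

Definition component_of_degree (d : nat) (x : HCK K) : HCK K :=
  \sum_(f <- msupp x | forest_size f == d) << x@_f *g f >>.

(* An element of the graded completion is the sequence of its homogeneous
   components. *)
Definition completed : Type := nat -> HCK K.

(* For x without constant term, x ^+ m has no component of degree d < m, so
   the truncated sum is the degree d component of exp(x). *)
Definition exp_completed (x : HCK K) : completed := fun d =>
  \sum_(m < d.+1) (m`!%:R)^-1 *: component_of_degree d (x ^+ m).

Definition Bplus_completed (u : completed) : completed := fun d =>
  if d is d'.+1 then Bplus (u d') else 0.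

Definition Z_ (n : nat) (b : K) : completed :=
  Bplus_completed (exp_completed (\sum_(1 <= k < n) p_ k + b *: p_ n)).

End HopfAlgebra.

Arguments ladder K n : clear implicits.

(* Main.v *)
(** Write [t_(m+1) = B_+(y_m)]. If [lambda_(i,j) = a_j] for all [i], the cocycle property
    of [B_+] shows that the part of [Delta(y_m)] whose left factor is a tree [T] with
    [j] vertices is [a_j <T, t_j> T (x) y_(m-j)]; in characteristic zero this recursion
    determines the sequence from the [a_j]. On decomposable elements the tree-by-tree part
    of [Delta] is symmetric, which gives [a_(i+j) (a_i - a_j) = 0]: up to rescaling [a] is
    constant, or equal to [1] below some [n], arbitrary at [n] and zero after [n].
    Conversely the [p_k] are primitive with linear part [l_k], so
    [E = exp(p_1 + ... + p_(n-1) + b p_n)] is grouplike and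
    [Delta(B_+(E)) = B_+(E) (x) 1 + E (x) B_+(E)], which realises every such [a];
    constant [a] is realised by the ladders. *)

From HB Require Import structures.
Require Import Defs.
From Stdlib Require Import Classical_Prop.
From mathcomp Require Import all_boot all_order all_algebra.
From mathcomp Require Import finmap monalg.

Set Implicit Arguments.
Unset Strict Implicit.
Unset Printing Implicit Defensive.

Import GRing.Theory.
Local Open Scope ring_scope.

(** Two things shape the converse. The subalgebra generated by the [t_n] must contain the left
    factors of their coproducts, so every component of the exponent has to be a polynomial in the
    [t_n]. The relation between the ladders and the [p_k] shows this for [p_k] as long as [t_j] is a
    rescaled ladder for all [j <= k], which holds while the earlier coefficients in the exponent
    equal one; hence a coefficient [b] other than one comes last. The array is then read from linear
    terms: [Delta(t_(m+1))] contains [E_j (x) t_(m+1-j)], so [lambda_(i,j)] is the coefficient of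
    [t_j] in the polynomial expressing [E_j], whatever [i] is. Exponentials and logarithms enter
    through Newton's identities [d E_d = sum_j j P_j E_(d-j)]: in characteristic zero they determine
    each of the two series from the other, given [E_0 = 1], and every fact about them becomes an
    induction on the degree. *)

(** * Opaque monoid algebras *)

(* [congr (_ + _)] would try to convert the corresponding summands. *)
Lemma congr_add (V : nmodType) (a b c d : V) : a = c -> b = d -> a + b = c + d.
Proof. by move=> -> ->. Qed.

(** Locked, like [prodm] below, so that unification never unfolds an operation over a finite
    support. *)
HB.lock Definition lext (K : fieldType) (M : choiceType) (V : lmodType K)
  (F : M -> V) (x : {malg K[M]}) : V := \sum_(k <- msupp x) x@_k *: F k.

HB.lock Definition prodm (I : choiceType) (R : comNzRingType) (F : I -> R)
  (m : {cmonom I}) : R := \prod_(i <- finsupp (cmonom_val m)) F i ^+ m i.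

Section LinearExtension.
Context (K : fieldType) (M : choiceType) (V : lmodType K) (F : M -> V).

Local Notation lext := (lext F).

Lemma lextE x : lext x = \sum_(k <- msupp x) x@_k *: F k.
Proof. by rewrite unlock. Qed.

Lemma lextEw (d : {fset M}) x : (msupp x `<=` d)%fset ->
  lext x = \sum_(k <- d) x@_k *: F k.
Proof.
move=> le; rewrite lextE (big_fset_incl _ le) //= => k _ /mcoeff_outdom ->.
by rewrite scale0r.
Qed.

Lemma lext_is_linear : linear lext.
Proof.
move=> a x y.
rewrite (lextEw (d := msupp x `|` msupp y)%fset); last first.
  by apply: fsubset_trans (msuppD_le _ _) _; apply: fsetSU; exact: msuppZ_le.
rewrite (lextEw (fsubsetUl _ (msupp y))) (lextEw (fsubsetUr (msupp x) _)).
rewrite scaler_sumr -big_split /=; apply: eq_bigr => k _.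
by rewrite mcoeffD mcoeffZ scalerDl scalerA.
Qed.

HB.instance Definition _ := GRing.isLinear.Build K {malg K[M]} V *:%R lext
  lext_is_linear.

Lemma lextU k : lext << k >> = F k.
Proof. by rewrite lextE msuppU oner_eq0 big_seq_fset1 mcoeffUU scale1r. Qed.

End LinearExtension.

Section MalgBasis.
Context (K : fieldType).

Lemma malgUZ (M : choiceType) (c : K) (k : M) : << c *g k >> = c *: << k >>.
Proof. by apply/malgP=> l; rewrite mcoeffZ !mcoeffU mulrnAr mulr1. Qed.

Lemma malg_sumE (M : choiceType) (x : {malg K[M]}) :
  x = \sum_(k <- msupp x) x@_k *: << k >>.
Proof. by rewrite [LHS]monalgE; apply: eq_bigr => k _; rewrite malgUZ. Qed.

Lemma malg_ind (M : choiceType) (P : {malg K[M]} -> Prop) :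
  P 0 -> (forall c k x, P x -> P (c *: << k >> + x)) -> forall x, P x.
Proof.
move=> P0 PD x; rewrite [x]malg_sumE.
by elim/big_rec: _ => // k y _; apply: PD.
Qed.

Lemma mcoeff_suml (M : choiceType) (I : Type) (r : seq I) (P : pred I)
    (F : I -> {malg K[M]}) l :
  (\sum_(i <- r | P i) F i)@_l = \sum_(i <- r | P i) (F i)@_l.
Proof. exact: raddf_sum. Qed.

Lemma malgUM (M : monomType) (k l : M) :
  << k >> * << l >> = << mmul k l >> :> {malg K[M]}.
Proof. by rewrite malgM_def fgmulUU mulr1. Qed.

Lemma mulPl (A : comAlgType K) (c : K) (x y z : A) :
  (c *: x + y) * z = c *: (x * z) + y * z.
Proof. by rewrite mulrDl scalerAl. Qed.

Lemma mulPr (A : comAlgType K) (c : K) (x y z : A) :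
  z * (c *: x + y) = c *: (z * x) + z * y.
Proof. by rewrite mulrDr scalerAr. Qed.

Lemma lextM (M : conomType) (A : comAlgType K) (F : M -> A) :
  {morph F : k l / mmul k l >-> k * l} -> {morph lext F : x y / x * y}.
Proof.
move=> FM x y; rewrite [x]malg_sumE [y]malg_sumE.
rewrite mulr_suml [LHS]linear_sum [X in X * _]linear_sum mulr_suml.
apply: eq_bigr => k _ /=.
rewrite mulr_sumr [LHS]linear_sum [X in _ * X]linear_sum mulr_sumr.
apply: eq_bigr => l _ /=; rewrite [lext F (_ *: << k >>)]linearZ.
rewrite [lext F (_ *: << l >>)]linearZ /= -!scalerAl -!scalerAr.
by rewrite !linearZ /= malgUM !lextU FM !scalerA mulrC.
Qed.

End MalgBasis.

Section MonomialProduct.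
Context (I : choiceType) (R : comNzRingType) (F : I -> R).

Local Notation prodm := (prodm F).

Lemma prodmE m : prodm m = \prod_(i <- finsupp (cmonom_val m)) F i ^+ m i.
Proof. by rewrite unlock. Qed.

Lemma prodmEw (d : {fset I}) (m : {cmonom I}) :
  (finsupp (cmonom_val m) `<=` d)%fset -> prodm m = \prod_(i <- d) F i ^+ m i.
Proof.
move=> le; rewrite prodmE (big_fset_incl _ le) //= => i _.
by rewrite memNfinsupp => /eqP ->.
Qed.

Lemma prodm1 : prodm mone = 1.
Proof. by rewrite prodmE mdom1 big_seq_fset0. Qed.

Lemma prodmU i : prodm (ucm i) = F i.
Proof. by rewrite prodmE mdomU big_seq_fset1 cmUU. Qed.

Lemma prodmM : {morph prodm : m n / mmul m n >-> m * n}.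
Proof.
move=> m n; rewrite prodmE mdomD.
rewrite (prodmEw (fsubsetUl _ (finsupp (cmonom_val n)))).
rewrite (prodmEw (fsubsetUr (finsupp (cmonom_val m)) _)) -big_split /=.
by apply: eq_bigr => i _; rewrite cmM exprD.
Qed.

End MonomialProduct.

Lemma cmonom_ind (I : choiceType) (P : {cmonom I} -> Prop) :
  P mone -> (forall i m, P m -> P (mmul (ucm i) m)) -> forall m, P m.
Proof.
move=> P1 PM m; move: {2}(mdeg m) (erefl (mdeg m)) => n.
elim: n m => [|n IH] m degm; first by rewrite (mdeg_eq0I degm).
have /fset0Pn[i im] : finsupp (cmonom_val m) != fset0.
  by apply/eqP => m0; move: degm; rewrite mdegE m0 big_seq_fset0.
have mE : m = mmul (ucm i) (divcm m (ucm i)).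
  apply/eqP/cmP => j; rewrite cmM divcmE cmU subnKC //.
  by case: eqVneq => //= <-; rewrite lt0n cmE_neq0.
rewrite mE; apply/PM/IH; move: degm.
by rewrite {1}mE mdegM mdegU => -[].
Qed.

Lemma cmonom_neq1P (I : choiceType) (m : {cmonom I}) :
  m != mone -> exists i n, m = mmul (ucm i) n.
Proof.
elim/cmonom_ind: m => [|i n _ _]; first by rewrite eqxx.
by exists i, n.
Qed.

(* The operations of [{malg K[M]}] reduce to manipulations of finite supports,
   on which every failing unification diverges: hence this opaque copy. *)
Lemma sealed_malg_exists (K : fieldType) (M : conomType) :
  {A : comAlgType K & {f : {malg K[M]} -> A & {g : A -> {malg K[M]} &
    {m : M -> A & {c : M -> A -> K |
      [/\ cancel f g /\ cancel g f, linear f, f 1 = 1 /\ {morph f : x y / x * y},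
          forall k, m k = f << k >> & forall k x, c k x = (g x)@_k]}}}}}.
Proof.
exists {malg K[M]}, id, id, (fun k => << k >>), (fun k x => x@_k).
by split=> // [a x y|]; split.
Qed.

Section Sealed.
Context (K : fieldType) (M : conomType).
Local Notation package := (sealed_malg_exists K M).

(** Since [sealed_malg_exists] is opaque, the five projections do not reduce, and [seal_spec] is all
    that is known about them. *)
Definition smalg : comAlgType K := projT1 package.

Definition seal : {malg K[M]} -> smalg := projT1 (projT2 package).

Definition unseal : smalg -> {malg K[M]} := projT1 (projT2 (projT2 package)).

Definition mon : M -> smalg := projT1 (projT2 (projT2 (projT2 package))).

Definition coef : M -> smalg -> K := sval (projT2 (projT2 (projT2 (projT2 package)))).

Lemma seal_spec :
  [/\ cancel seal unseal /\ cancel unseal seal, linear seal,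
      seal 1 = 1 /\ {morph seal : x y / x * y}, forall k, mon k = seal << k >>
    & forall k x, coef k x = (unseal x)@_k].
Proof. exact: (svalP (projT2 (projT2 (projT2 (projT2 package))))). Qed.

Lemma sealK : cancel seal unseal. Proof. by case: seal_spec => -[]. Qed.

Lemma unsealK : cancel unseal seal. Proof. by case: seal_spec => -[]. Qed.

Lemma seal_is_linear : linear seal. Proof. by case: seal_spec. Qed.

Lemma seal_is_monoid_morphism : monoid_morphism seal.
Proof. by case: seal_spec => _ _ [? ?]; split. Qed.

Lemma monE k : mon k = seal << k >>. Proof. by case: seal_spec. Qed.

Lemma fcoefE k x : coef k x = (unseal x)@_k. Proof. by case: seal_spec. Qed.

HB.instance Definition _ := GRing.isLinear.Build K {malg K[M]} smalg *:%R seal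
  seal_is_linear.
HB.instance Definition _ := GRing.isMonoidMorphism.Build {malg K[M]} smalg seal
  seal_is_monoid_morphism.

Lemma sealDA x y z : seal (x + y + z) = seal x + seal (y + z).
Proof. by rewrite -addrA linearD. Qed.

Lemma unseal_is_linear : linear unseal.
Proof.
move=> a x y; apply: (can_inj sealK).
by rewrite unsealK [RHS]linearP /= !unsealK.
Qed.

HB.instance Definition _ := GRing.isLinear.Build K smalg {malg K[M]} *:%R unseal
  unseal_is_linear.

Lemma coef_is_linear k : linear_for *%R (coef k).
Proof. by move=> a x y; rewrite !fcoefE linearP mcoeffD mcoeffZ. Qed.

HB.instance Definition _ k := GRing.isLinear.Build K smalg K *%R (coef k)
  (coef_is_linear k).

Lemma fcoefPl k a x y : coef k (a *: x + y) = a * coef k x + coef k y.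
Proof. exact: linearP. Qed.

Lemma fcoef0 k : coef k 0 = 0. Proof. exact: linear0. Qed.

Lemma fcoefD k x y : coef k (x + y) = coef k x + coef k y.
Proof. exact: linearD. Qed.

Lemma fcoefB k x y : coef k (x - y) = coef k x - coef k y.
Proof. exact: linearB. Qed.

Lemma fcoefZ k a x : coef k (a *: x) = a * coef k x.
Proof. exact: linearZ_LR. Qed.

Lemma fcoef_sum k (I : Type) (r : seq I) (P : pred I) (F : I -> smalg) :
  coef k (\sum_(i <- r | P i) F i) = \sum_(i <- r | P i) coef k (F i).
Proof. exact: linear_sum. Qed.

Lemma coef_seal k (x : {malg K[M]}) : coef k (seal x) = x@_k.
Proof. by rewrite fcoefE sealK. Qed.

Lemma coef_mon k l : coef k (mon l) = (l == k)%:R.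
Proof. by rewrite monE coef_seal mcoeffU1. Qed.

Lemma fcoefP x y : (forall k, coef k x = coef k y) -> x = y.
Proof.
by move=> xy; apply: (can_inj unsealK); apply/malgP=> k; rewrite -!fcoefE.
Qed.

Lemma mon1 : mon mone = 1.
Proof. by rewrite monE; apply: (rmorph1 seal). Qed.

Lemma monM k l : mon (mmul k l) = mon k * mon l.
Proof. by rewrite !monE -malgUM rmorphM. Qed.

Lemma smalg_ind (P : smalg -> Prop) :
  P 0 -> (forall c k x, P x -> P (c *: mon k + x)) -> forall x, P x.
Proof.
move=> P0 PD x; rewrite -[x]unsealK.
elim/malg_ind: (unseal x) => [|c k y IH]; first by rewrite linear0.
by rewrite linearP /= -monE; apply: PD.
Qed.

Definition support (x : smalg) : seq M := msupp (unseal x).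

Lemma supportP k x : (k \in support x) = (coef k x != 0).
Proof. by rewrite fcoefE mcoeff_neq0. Qed.

Lemma support_uniq x : uniq (support x).
Proof. exact: fset_uniq. Qed.

Lemma smalg_sumE x : x = \sum_(k <- support x) coef k x *: mon k.
Proof.
rewrite -[LHS]unsealK {1}[unseal x]malg_sumE linear_sum.
by apply: eq_bigr => k _; rewrite linearZ monE fcoefE.
Qed.

Lemma sum_support_delta x k c :
  \sum_(l <- support x) coef l x * (if l == k then c else 0) = coef k x * c.
Proof.
have [kx|kx] := boolP (k \in support x).
  rewrite (bigD1_seq k) ?support_uniq //= eqxx big1 ?addr0 // => l.
  by move/negbTE=> ->; rewrite mulr0.
rewrite big1_seq => [|l /andP[_ lx]]; last first.
  by case: (l =P k) kx => [<-|]; rewrite ?lx ?mulr0.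
by move: kx; rewrite supportP negbK => /eqP->; rewrite mul0r.
Qed.

Definition lextend (V : lmodType K) (F : M -> V) (x : smalg) : V :=
  lext F (unseal x).

Section Lextend.
Context (V : lmodType K) (F : M -> V).

Lemma lextend_is_linear : linear (lextend F).
Proof. by move=> a x y; rewrite /lextend linearP linearP. Qed.

HB.instance Definition _ := GRing.isLinear.Build K smalg V *:%R (lextend F)
  lextend_is_linear.

Lemma lextend_mon k : lextend F (mon k) = F k.
Proof. by rewrite /lextend monE sealK lextU. Qed.

Lemma lextend_seal x : lextend F (seal x) = lext F x.
Proof. by rewrite /lextend sealK. Qed.

Lemma lextendE x : lextend F x = \sum_(k <- support x) coef k x *: F k.
Proof. by rewrite /lextend lextE; apply: eq_bigr => k _; rewrite fcoefE. Qed.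

End Lextend.

Lemma lextendM (A : comAlgType K) (F : M -> A) :
  {morph F : k l / mmul k l >-> k * l} -> {morph lextend F : x y / x * y}.
Proof.
move=> FM x y; rewrite /lextend -(lextM FM).
by rewrite -[x in LHS]unsealK -[y in LHS]unsealK -rmorphM sealK.
Qed.

End Sealed.

(** * Tensor products in the sealed algebras *)

Section Tensor.
Context (K : fieldType) (M N : conomType).
Local Notation A := (smalg K M).
Local Notation B := (smalg K N).
Local Notation C := (smalg K (M * N)%type).

Definition tensor (x : A) (y : B) : C :=
  lextend (fun k => lextend (fun l => mon K (k, l)) y) x.

Lemma tensorPl c (x x' : A) (y : B) :
  tensor (c *: x + x') y = c *: tensor x y + tensor x' y.
Proof. exact: linearP. Qed.

Lemma tensorPr c (x : A) (y y' : B) :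
  tensor x (c *: y + y') = c *: tensor x y + tensor x y'.
Proof.
rewrite /tensor !lextendE scaler_sumr -big_split; apply: eq_bigr => k _ /=.
by rewrite linearP scalerDr !scalerA mulrC.
Qed.

(** Exchanges the arguments so that linearity in the first one can also be declared as an
    instance. *)
Definition tensor_flip (y : B) (x : A) : C := tensor x y.

HB.instance Definition _ y := GRing.isLinear.Build K A C *:%R
  (tensor_flip y) (fun c x x' => tensorPl c x x' y).
HB.instance Definition _ x := GRing.isLinear.Build K B C *:%R
  (tensor x) (fun c y y' => tensorPr c x y y').

Lemma tensor_mon (k : M) (l : N) : tensor (mon K k) (mon K l) = mon K (k, l).
Proof. by rewrite /tensor !lextend_mon. Qed.

Lemma tensor0l (y : B) : tensor 0 y = 0.
Proof. exact: (linear0 (tensor_flip y)). Qed.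

Lemma tensor0r (x : A) : tensor x 0 = 0.
Proof. exact: linear0. Qed.

Lemma tensorZl a (x : A) (y : B) : tensor (a *: x) y = a *: tensor x y.
Proof. exact: (linearZ_LR (tensor_flip y)). Qed.

Lemma tensorZr a (x : A) (y : B) : tensor x (a *: y) = a *: tensor x y.
Proof. exact: linearZ_LR. Qed.

Lemma tensor_suml (I : Type) (r : seq I) (P : pred I) (F : I -> A) y :
  tensor (\sum_(i <- r | P i) F i) y = \sum_(i <- r | P i) tensor (F i) y.
Proof. exact: (linear_sum (tensor_flip y)). Qed.

Lemma tensor_sumr (I : Type) (r : seq I) (P : pred I) (F : I -> B) x :
  tensor x (\sum_(i <- r | P i) F i) = \sum_(i <- r | P i) tensor x (F i).
Proof. exact: linear_sum. Qed.

Lemma coef_tensor (k : M) (l : N) x y :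
  coef (k, l) (tensor x y) = coef k x * coef l y.
Proof.
elim/smalg_ind: x => [|c k' x IH]; first by rewrite tensor0l !fcoef0 mul0r.
rewrite tensorPl !fcoefPl IH mulrDl -mulrA; congr (_ * _ + _) => {IH}.
elim/smalg_ind: y => [|d l' y IH]; first by rewrite tensor0r !fcoef0 mulr0.
rewrite tensorPr !fcoefPl IH mulrDr mulrCA; congr (_ * _ + _).
by rewrite tensor_mon !coef_mon xpair_eqE -mulnb natrM.
Qed.

Lemma tensorM (x x' : A) (y y' : B) :
  tensor x y * tensor x' y' = tensor (x * x') (y * y').
Proof.
elim/smalg_ind: x => [|c f x IH]; first by rewrite mul0r !tensor0l mul0r.
rewrite tensorPl !mulPl tensorPl IH; congr (_ *: _ + _) => {IH}.
elim/smalg_ind: y => [|d g y IH]; first by rewrite mul0r !tensor0r mul0r.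
rewrite tensorPr !mulPl tensorPr IH; congr (_ *: _ + _) => {IH}.
elim/smalg_ind: x' => [|c' f' x' IH]; first by rewrite mulr0 !tensor0l mulr0.
rewrite tensorPl !mulPr tensorPl IH; congr (_ *: _ + _) => {IH}.
elim/smalg_ind: y' => [|d' g' y' IH]; first by rewrite mulr0 !tensor0r mulr0.
rewrite tensorPr !mulPr tensorPr IH; congr (_ *: _ + _) => {IH}.
by rewrite !tensor_mon -!monM tensor_mon.
Qed.

Lemma tensor11 : tensor 1 1 = 1.
Proof. by rewrite -!mon1 tensor_mon. Qed.

End Tensor.

Section TensorSeal.
Context (K : fieldType).

Lemma sum_msupp_delta (M : choiceType) (V : zmodType) (x : {malg K[M]}) (k : M)
    (v : V) : \sum_(l <- msupp x) v *+ (l == k) = v *+ (k \in msupp x).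
Proof.
have [kx|kx] := boolP (k \in msupp x).
  rewrite (big_fsetD1 k) // eqxx big1_fset; first exact: addr0.
  by move=> l; rewrite in_fsetD1 => /andP[/negbTE -> _] _.
rewrite big1_fset // => l lx _.
by case: eqP lx => [->|//]; rewrite (negbTE kx).
Qed.

Lemma mcoeff_tens (x y : HCK K) (f g : forest) : (tens x y)@_(f, g) = x@_f * y@_g.
Proof.
rewrite /tens mcoeff_suml.
transitivity (\sum_(f' <- msupp x) (x@_f * y@_g) *+ (f' == f)).
  apply: eq_bigr => f' _; rewrite mcoeff_suml.
  transitivity (\sum_(g' <- msupp y) (x@_f * y@_g) *+ (f' == f) *+ (g' == g)).
    apply: eq_bigr => g' _; rewrite mcoeffU xpair_eqE.
    by do 2!case: eqP => [->|_].
  rewrite sum_msupp_delta; case: (msuppP y g) => _; first exact: mulr1n.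
  by rewrite mulr0 mul0rn.
rewrite sum_msupp_delta; case: (msuppP x f) => _; first exact: mulr1n.
by rewrite mul0r.
Qed.

Lemma seal_tens (x y : HCK K) :
  seal (tens x y) = tensor (seal x) (seal y).
Proof.
by apply: fcoefP => -[f g]; rewrite coef_tensor !coef_seal mcoeff_tens.
Qed.

End TensorSeal.

(** * Trees and forests *)

Lemma ptree_le_total : total ptree_le.
Proof. by move=> t u; rewrite /ptree_le -lock leq_total. Qed.

Lemma ptree_le_trans : transitive ptree_le.
Proof. by move=> t u v; rewrite /ptree_le -lock; apply: leq_trans. Qed.

Lemma ptree_le_anti : antisymmetric ptree_le.
Proof.
move=> t u; rewrite /ptree_le -lock -eqn_leq => /eqP.
exact: (pcan_inj choice.pickleK).
Qed.

Lemma canon_id t : canonical t -> canon t = t.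
Proof.
elim/ptree_nested_ind: t => s IH /= /andP[s_sorted s_can]; congr PNode.
have -> : map canon s = s.
  apply: (@eq_from_nth _ (PNode [::])) => [|i]; rewrite size_map // => lti.
  rewrite (nth_map (PNode [::])) // IH //.
  by move/all_nthP: s_can => /(_ false i); rewrite size_map (nth_map (PNode [::])) // => ->.
exact: sorted_sort ptree_le_trans _ s_sorted.
Qed.

Lemma rtree_of_val (T : rtree) : rtree_of (val T) = T.
Proof. by apply: val_inj; rewrite /= canon_id //; case: T. Qed.

Lemma rtree_of_canon t : rtree_of (canon t) = rtree_of t.
Proof. exact: (rtree_of_val (rtree_of t)). Qed.

Definition forest_of (l : seq ptree) : forest :=
  (\big[mmul/mone]_(u <- l) ucm (rtree_of u))%M.

Lemma forest_of_count l T : forest_of l T = count_mem T (map rtree_of l).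
Proof.
rewrite /forest_of; elim: l => [|u l IH]; first by rewrite big_nil cm1.
by rewrite big_cons cmM cmU IH.
Qed.

Lemma perm_forest_of l l' :
  forest_of l = forest_of l' -> perm_eq (map rtree_of l) (map rtree_of l').
Proof.
move=> ll'; apply/allP=> T _ /=.
by rewrite -!forest_of_count ll'.
Qed.

Lemma graft_list_of (f : forest) :
  forest_of (flatten [seq nseq (f t) (val t) | t <- finsupp (cmonom_val f)]) = f.
Proof.
apply/eqP/cmP => T; rewrite forest_of_count count_map count_flatten -map_comp.
rewrite sumnE big_map (eq_bigr (fun t => (if t == T then f T else 0)%N)).
  case: (mdomP f T) => [Tf|Tf]; last by rewrite big1 // => t _; rewrite if_same.
  rewrite (big_fsetD1 T) // eqxx big1_fset; first exact: addn0.
  by move=> t; rewrite in_fsetD1 => /andP[/negbTE ->].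
move=> t _ /=; rewrite count_nseq /= rtree_of_val.
by case: eqP => [->|_]; rewrite ?mul1n ?mul0n.
Qed.

(** Canonical forms sort the children, so only the multiset of their classes matters. *)
Lemma rtree_of_perm l l' : forest_of l = forest_of l' ->
  rtree_of (PNode l) = rtree_of (PNode l').
Proof.
move/perm_forest_of/(perm_map val); rewrite -!map_comp => ll'.
apply: val_inj => /=; congr PNode.
by apply/perm_sortP => //;
  [exact: ptree_le_total | exact: ptree_le_trans | exact: ptree_le_anti].
Qed.

Lemma graft_forest_of l : graft (forest_of l) = rtree_of (PNode l).
Proof. by apply: rtree_of_perm; rewrite graft_list_of. Qed.

Definition ungraft (T : rtree) : forest := forest_of (children (val T)).

Lemma ungraftK : cancel ungraft graft.
Proof.
move=> T; rewrite graft_forest_of -[RHS]rtree_of_val; congr rtree_of.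
by case: (val T).
Qed.

Lemma graftK : cancel graft ungraft.
Proof.
move=> f; rewrite -[f in RHS]graft_list_of; set l := flatten _.
apply/eqP/cmP => T; rewrite !forest_of_count /=.
have /(perm_map rtree_of)/permP -> : perm_eq (sort ptree_le (map canon l)) (map canon l).
  by rewrite perm_sort.
by rewrite -map_comp; congr count; apply: eq_map => u /=; rewrite rtree_of_canon.
Qed.

Lemma graft_inj : injective graft. Proof. exact: can_inj graftK. Qed.

Lemma forest_sizeEw (d : {fset rtree}) (f : forest) :
  (finsupp (cmonom_val f) `<=` d)%fset ->
  forest_size f = (\sum_(t <- d) f t * tree_size t)%N.
Proof.
move=> le; rewrite /forest_size (big_fset_incl _ le) //= => t _.
by rewrite memNfinsupp => /eqP ->.
Qed.

Lemma forest_size1 : forest_size mone = 0%N.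
Proof. by rewrite /forest_size mdom1 big_seq_fset0. Qed.

Lemma forest_sizeU T : forest_size (ucm T) = tree_size T.
Proof. by rewrite /forest_size mdomU big_seq_fset1 cmUU mul1n. Qed.

Lemma forest_sizeM (f g : forest) :
  forest_size (mmul f g) = (forest_size f + forest_size g)%N.
Proof.
rewrite (forest_sizeEw (fsubsetUl (finsupp (cmonom_val f)) (finsupp (cmonom_val g)))).
rewrite (forest_sizeEw (fsubsetUr (finsupp (cmonom_val f)) (finsupp (cmonom_val g)))).
rewrite /forest_size mdomD -big_split /=.
by apply: eq_bigr => i _; rewrite cmM mulnDl.
Qed.

Lemma tree_size_gt0 T : (0 < tree_size T)%N.
Proof. by rewrite /tree_size; case: (val T). Qed.

Lemma forest_size_eq0 f : (forest_size f == 0%N) = (f == mone).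
Proof.
elim/cmonom_ind: f => [|T f _]; first by rewrite forest_size1 !eqxx.
rewrite forest_sizeM forest_sizeU addn_eq0 cmM_eq1 cm1_eq1.
by rewrite eqn0Ngt tree_size_gt0.
Qed.

Lemma tree_size_graft f : tree_size (graft f) = (forest_size f).+1.
Proof.
rewrite -[f in RHS]graft_list_of /graft; set l := flatten _.
rewrite /tree_size /= ; congr S; rewrite sumnE big_map.
transitivity (\sum_(u <- map canon l) ptree_size u)%N.
  by apply: perm_big; rewrite perm_sort.
rewrite big_map /forest_of.
rewrite (big_morph forest_size forest_sizeM forest_size1).
by apply: eq_bigr => u _; rewrite forest_sizeU.
Qed.

(** * Admissible cuts *)

Lemma eq_sum_seq (V : nmodType) (I : eqType) (r : seq I) (P Q : pred I)
    (F G : I -> V) :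
  (forall i, i \in r -> P i = Q i) -> (forall i, i \in r -> F i = G i) ->
  \sum_(i <- r | P i) F i = \sum_(i <- r | Q i) G i.
Proof.
move=> PQ FG; rewrite big_mkcond [RHS]big_mkcond big_seq [RHS]big_seq.
by apply: eq_bigr => i ri; rewrite PQ // FG.
Qed.

Section Sublists.
Context (T : eqType).
Implicit Types (E C : seq T).

(** Cuts are traded for sublists of the list of edges, because a sum over the sublists of a
    concatenation becomes a double sum ([big_sublists_cat]). *)
Fixpoint sublists E : seq (seq T) :=
  if E is e :: E' then map (cons e) (sublists E') ++ sublists E' else [:: [::]].

Lemma sublists_sub E C : C \in sublists E -> {subset C <= E}.
Proof.
elim: E C => [|e E IH] C /=; first by rewrite inE => /eqP ->.
rewrite mem_cat => /orP[/mapP[D /IH DE ->] x|/IH CE x /CE xE].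
  by rewrite !inE => /orP[->//|/DE ->]; rewrite orbT.
by rewrite inE xE orbT.
Qed.

Lemma sublists_filter E C : uniq E -> C \in sublists E -> [seq x <- E | x \in C] = C.
Proof.
elim: E C => [|e E IH] C /=; first by rewrite inE => _ /eqP ->.
case/andP=> eE uE; rewrite mem_cat => /orP[/mapP[D DE ->]|CE].
  rewrite inE eqxx /=; congr cons; rewrite -[RHS](IH _ uE DE).
  by apply: eq_in_filter => x xE; rewrite inE; case: eqP xE eE => // -> ->.
by rewrite ifN ?IH //; apply: contra eE => /(sublists_sub CE).
Qed.

Lemma mem_sublists E (p : pred T) : filter p E \in sublists E.
Proof.
elim: E => [|e E IH] //=; rewrite mem_cat.
by case: (p e); rewrite ?IH ?orbT // (map_f (cons e) IH).
Qed.

Lemma sublists_uniq E : uniq E -> uniq (sublists E).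
Proof.
elim: E => [|e E IH] //= /andP[eE /IH uE].
rewrite cat_uniq uE andbT map_inj_uniq ?uE; last by move=> ? ? [].
apply/hasPn => C /sublists_sub CE; apply/mapP => -[D _ CD].
by move: eE; rewrite CE // CD mem_head.
Qed.

Lemma big_sublists_cat (R : nmodType) E E' (F : seq T -> R) :
  \sum_(C <- sublists (E ++ E')) F C
    = \sum_(C <- sublists E) \sum_(C' <- sublists E') F (C ++ C').
Proof.
elim: E F => [|e E IH] F /=; first by rewrite big_seq1.
by rewrite !big_cat !big_map /= !IH.
Qed.

Lemma big_sublists_cons (R : nmodType) e E (P : pred (seq T)) (F : seq T -> R) :
  \sum_(C <- sublists (e :: E) | P C) F C
    = \sum_(C <- sublists E | P (e :: C)) F (e :: C)
      + \sum_(C <- sublists E | P C) F C.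
Proof. by rewrite big_cat big_map. Qed.

Lemma big_sublists_nil (R : nmodType) E (P : pred (seq T)) (F : seq T -> R) :
  uniq E -> (forall C, C != [::] -> {subset C <= E} -> P C -> F C = 0) ->
  P [::] -> \sum_(C <- sublists E | P C) F C = F [::].
Proof.
move=> uE F0 P0; rewrite big_mkcond (bigD1_seq [::]) /=; last 2 first.
- by rewrite -(filter_pred0 E) mem_sublists.
- exact: sublists_uniq.
rewrite P0 big1_seq ?addr0 // => C /andP[C0 /sublists_sub CE].
by case: ifP => // /F0 ->.
Qed.

End Sublists.

Lemma sublists_map (T U : eqType) (h : T -> U) E :
  sublists (map h E) = map (map h) (sublists E).
Proof. by elim: E => [|e E IH] //=; rewrite map_cat IH -!map_comp. Qed.

Section SubsetsOfSequence.
Context (T : choiceType) (E : seq T).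
Hypothesis uE : uniq E.
Implicit Types c : {set seq_sub E}.

Definition values c : seq T := [seq x <- E | x \in [seq val e | e in c]].

Lemma mem_values c (e : seq_sub E) : (val e \in values c) = (e \in c).
Proof. by rewrite mem_filter (ssvalP e) andbT mem_image //; apply: val_inj. Qed.

Lemma values_inj : injective values.
Proof. by move=> c d cd; apply/setP => e; rewrite -!mem_values cd. Qed.

Lemma perm_values c : perm_eq [seq val e | e in c] (values c).
Proof.
apply: uniq_perm; first by rewrite map_inj_uniq ?enum_uniq //; apply: val_inj.
  exact: filter_uniq.
move=> x; rewrite mem_filter; case: (boolP (x \in E)); first by rewrite andbT.
by rewrite andbF => xE; apply/negbTE; apply: contra xE => /imageP[e _ ->]; apply: ssvalP.
Qed.

(** Listing a subset in the order of [E] is a bijection onto the sublists of [E]; its inverse takes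
    a sublist to the set of its members. *)
Lemma sum_values (R : nmodType) (F : seq T -> R) :
  \sum_c F (values c) = \sum_(C <- sublists E) F C.
Proof.
rewrite -(big_map values xpredT F); apply: perm_big.
apply: uniq_perm; last 1 first.
- move=> C; apply/mapP/idP => [[c _ ->]|CE]; first exact: mem_sublists.
  exists [set e | val e \in C]; first by rewrite mem_index_enum.
  rewrite -[LHS](sublists_filter uE CE); apply: eq_in_filter => x xE.
  apply/idP/imageP => [xC|[e]]; last by rewrite inE => + ->.
  by exists (SeqSub xE); rewrite ?inE.
- by rewrite map_inj_uniq ?index_enum_uniq //; apply: values_inj.
- exact: sublists_uniq.
Qed.

End SubsetsOfSequence.

(* In a sequence of trees, the vertices of the tree of rank [i] get the prefix
   [m + i]: the offset [m] makes induction on the sequence possible. *)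
Definition vertices_from (m : nat) (s : seq ptree) : seq (seq nat) :=
  flatten [seq map (cons p.1) p.2 | p <- zip (iota m (size s)) (map vertices s)].

Definition subtree_from (m : nat) (s : seq ptree) (v : seq nat) : ptree :=
  if v is i :: v' then subtree (nth (PNode [::]) s (i - m)) v' else PNode [::].

Definition leaves_from (m : nat) (s : seq ptree) : seq (seq nat) :=
  [seq v <- vertices_from m s | children (subtree_from m s v) == [::]].

Definition roots_from (m : nat) (s : seq ptree) (c : pred (seq nat)) :
    seq ptree :=
  [seq p.2 (fun v => c (p.1 :: v))
     | p <- zip (iota m (size s)) (map root_component s) & ~~ c [:: p.1]].

Definition head_ge (m : nat) (v : seq nat) : bool :=
  if v is i :: _ then (m <= i)%N else false.

Lemma root_component_node s c : root_component (PNode s) c = PNode (roots_from 0 s c).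
Proof. by []. Qed.

Lemma roots_from_cons m u s c : roots_from m (u :: s) c =
  (if c [:: m] then [::] else [:: root_component u (fun v => c (m :: v))])
    ++ roots_from m.+1 s c.
Proof. by rewrite /roots_from /=; case: (c [:: m]). Qed.

(** Extensionality on the subtrees is a hypothesis here, so that the lemma can be applied within the
    induction proving [root_component_ext]. *)
Lemma roots_from_ext m s (c d : pred (seq nat)) :
  (forall i, (i < size s)%N -> forall c d : pred (seq nat), c =1 d ->
     root_component (nth (PNode [::]) s i) c
       = root_component (nth (PNode [::]) s i) d) ->
  (forall v, head_ge m v -> c v = d v) -> roots_from m s c = roots_from m s d.
Proof.
elim: s m => [|u s IHs] m // IH cd; rewrite !roots_from_cons (cd [:: m]) /= ?leqnn //.
rewrite (IHs m.+1); last 2 first.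
- by move=> i; apply: (IH i.+1).
- by case=> [|i v] //= /ltnW im; apply: cd.
rewrite (IH 0%N _ _ (fun v => d (m :: v))) //= => v.
by apply: cd; rewrite /= leqnn.
Qed.

Lemma root_component_ext t (c d : pred (seq nat)) :
  c =1 d -> root_component t c = root_component t d.
Proof.
elim/ptree_nested_ind: t c d => s IH c d cd; rewrite !root_component_node.
by congr PNode; apply: roots_from_ext.
Qed.

(** The value of [c] at the root is left free because [root_component] never tests it; this covers
    the cut made at the root itself. *)
Lemma root_component_uncut t (c : pred (seq nat)) :
  (forall v, v != [::] -> c v = false) -> root_component t c = t.
Proof.
elim/ptree_nested_ind: t c => s IH c cd; rewrite root_component_node; congr PNode.
elim: s (0%N) IH => [|u s IHs] m IH //; rewrite roots_from_cons cd //=.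
rewrite (IH 0%N) //= ?IHs // => [i|v _]; first exact: (IH i.+1).
exact: cd.
Qed.

Lemma head_ge_vertices_from m s : all (head_ge m) (vertices_from m s).
Proof.
elim: s m => [|u s IH] m //=; rewrite /vertices_from /= all_cat all_map.
apply/andP; split; first by apply/allP => v _ /=.
by apply: sub_all (IH m.+1) => -[|i v] //=; apply: ltnW.
Qed.

Lemma vertices_from_cons m u s :
  vertices_from m (u :: s) = map (cons m) (vertices u) ++ vertices_from m.+1 s.
Proof. by []. Qed.

Lemma subtree_from_consl m u s v : subtree_from m (u :: s) (m :: v) = subtree u v.
Proof. by rewrite /= subnn. Qed.

Lemma subtree_from_consr m u s v :
  head_ge m.+1 v -> subtree_from m (u :: s) v = subtree_from m.+1 s v.
Proof. by case: v => [|i v] //= lti; rewrite -(subnSK lti). Qed.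

Lemma leaves_from_cons m u s :
  leaves_from m (u :: s) = map (cons m) (leaves u) ++ leaves_from m.+1 s.
Proof.
rewrite /leaves_from vertices_from_cons filter_cat filter_map; congr (_ ++ _).
  by congr map; apply: eq_filter => v; rewrite /= subnn.
apply: eq_in_filter => v /(allP (head_ge_vertices_from m.+1 s)) vm.
by rewrite subtree_from_consr.
Qed.

Lemma vertices_node s : vertices (PNode s) = [::] :: vertices_from 0 s.
Proof. by []. Qed.

Lemma edges_node s : edges (PNode s) = vertices_from 0 s.
Proof.
rewrite /edges vertices_node /=; apply/all_filterP.
by apply: sub_all (head_ge_vertices_from 0 s) => -[].
Qed.

Lemma vertices_edges u : vertices u = [::] :: edges u.
Proof. by case: u => s; rewrite edges_node. Qed.

Lemma subtree_node s v : v != [::] -> subtree (PNode s) v = subtree_from 0 s v.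
Proof. by case: v => [|i v] //= _; rewrite subn0. Qed.

Lemma leaves_node s : s != [::] -> leaves (PNode s) = leaves_from 0 s.
Proof.
move=> s0; rewrite /leaves vertices_node /= (negbTE s0).
apply: eq_in_filter => v /(allP (head_ge_vertices_from 0 s)) v0.
by rewrite subtree_node //; case: (v) v0.
Qed.

Lemma vertices_uniq u : uniq (vertices u).
Proof.
elim/ptree_nested_ind: u => s; rewrite vertices_node /= => IH.
apply/andP; split; first by apply/negP => /(allP (head_ge_vertices_from 0 s)).
elim: s (0%N) IH => [|u s IHs] m IH //; rewrite vertices_from_cons cat_uniq.
rewrite map_inj_uniq; last by move=> ? ? [].
rewrite (IH 0%N) // IHs ?andbT; last by move=> i; apply: (IH i.+1).
apply/hasPn => v /(allP (head_ge_vertices_from m.+1 s)) vm.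
by apply/mapP => -[w _ vw]; rewrite vw /= ltnn in vm.
Qed.

Lemma edges_uniq u : uniq (edges u).
Proof. exact: filter_uniq (vertices_uniq u). Qed.

(** Makes the root incompatible with any other vertex of a cut: the path to a leaf below that vertex
    would be crossed twice. *)
Lemma leaf_below u v : v \in vertices u -> exists2 l, l \in leaves u & prefix v l.
Proof.
elim/ptree_nested_ind: u v => s IH v.
have [->|s0] := eqVneq s [::].
  by rewrite mem_seq1 => /eqP ->; exists [::].
rewrite leaves_node // vertices_node inE => /orP[/eqP ->|].
  case: s s0 IH => // u s _ IH; rewrite leaves_from_cons.
  have [|l lu _] := IH 0%N isT [::]; first by rewrite vertices_edges mem_head.
  by exists (0%N :: l); rewrite // mem_cat (map_f (cons 0%N) lu).
clear s0; elim: s (0%N) IH => [|u s IHs] m IH //.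
rewrite vertices_from_cons leaves_from_cons mem_cat => /orP[/mapP[w wu ->]|vs].
  have [l lu wl] := IH 0%N isT w wu; exists (m :: l).
    by rewrite mem_cat (map_f (cons m) lu).
  by rewrite /= eqxx.
have [i|l ls vl] := IHs m.+1 _ vs; first exact: (IH i.+1).
by exists l; rewrite // mem_cat ls orbT.
Qed.

(** * Sums over admissible cuts and the recursion for the coproduct of a tree *)

Section CutSums.
Context (K : fieldType).
Local Notation H2 := (smalg K (forest * forest)%type).
Implicit Types (C : seq (seq nat)) (u : ptree) (s : seq ptree).

Lemma mon_pairM (f f' g g' : forest) :
  mon K (mmul f f', mmul g g') = mon K (f, g) * mon K (f', g').
Proof. by rewrite -monM. Qed.

Lemma mon_congr (f f' g g' : forest) :
  f = f' -> g = g' -> mon K (f, g) = mon K (f', g').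
Proof. by move=> -> ->. Qed.

Definition crosses_once (L C : seq (seq nat)) : bool :=
  all (fun l => (count (fun e => prefix e l) C <= 1)%N) L.

Definition pruned_by (sub : seq nat -> ptree) C : forest :=
  (\big[mmul/mone]_(e <- C)
     ucm (rtree_of (root_component (sub e) (fun w => e ++ w \in C))))%M.

Definition root_forest u C : forest :=
  if [::] \in C then mone else ucm (rtree_of (root_component u (mem C))).

(* Here a cut may also remove the whole tree, which is encoded by cutting the
   root. *)
Definition tree_cuts u : H2 :=
  \sum_(C <- sublists (vertices u) | crosses_once (leaves u) C)
     mon K (pruned_by (subtree u) C, root_forest u C).

Definition forest_cuts (m : nat) s : H2 :=
  \sum_(C <- sublists (vertices_from m s) | crosses_once (leaves_from m s) C)
     mon K (pruned_by (subtree_from m s) C, forest_of (roots_from m s (mem C))).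

Lemma mem_cat_consl m C C' v : all (head_ge m.+1) C' ->
  (m :: v \in map (cons m) C ++ C') = (v \in C).
Proof.
move=> C'm; rewrite mem_cat mem_map => [|? ? []//].
case: (boolP (_ \in C')) => [/(allP C'm)|]; last by rewrite orbF.
by rewrite /= ltnn.
Qed.

Lemma mem_cat_consr m C C' v : head_ge m.+1 v ->
  (v \in map (cons m) C ++ C') = (v \in C').
Proof.
move=> vm; rewrite mem_cat orbC; case: (boolP (v \in C')) => //= _.
by apply/mapP => -[w _ vw]; rewrite vw /= ltnn in vm.
Qed.

Lemma crosses_once_cons m u s C C' : all (head_ge m.+1) C' ->
  crosses_once (leaves_from m (u :: s)) (map (cons m) C ++ C')
    = crosses_once (leaves u) C && crosses_once (leaves_from m.+1 s) C'.
Proof.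
move=> C'm; rewrite /crosses_once leaves_from_cons all_cat all_map.
congr andb; first apply: eq_all => l /=.
  rewrite count_cat count_map [count _ C'](_ : _ = 0%N) ?addn0.
    by congr (_ <= _)%N; apply: eq_count => e /=; rewrite eqxx.
  apply/eqP; rewrite eqn0Ngt -has_count; apply/hasPn => e /(allP C'm).
  by case: e => [|i e] //= im; rewrite gtn_eqF.
apply: eq_in_all => l; rewrite mem_filter => /andP[_].
move/(allP (head_ge_vertices_from m.+1 s)) => lm.
rewrite count_cat count_map [count _ C](_ : _ = 0%N) ?add0n //.
apply/eqP; rewrite eqn0Ngt -has_count; apply/hasPn => e _ /=.
by case: l lm => [|i l] //= im; rewrite ltn_eqF.
Qed.

Lemma pruned_by_cons m u s C C' : all (head_ge m.+1) C' ->
  pruned_by (subtree_from m (u :: s)) (map (cons m) C ++ C')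
    = mmul (pruned_by (subtree u) C) (pruned_by (subtree_from m.+1 s) C').
Proof.
move=> C'm; rewrite /pruned_by big_cat big_map; congr mmul.
  apply: eq_bigr => e _; rewrite subtree_from_consl; congr (ucm (rtree_of _)).
  by apply: root_component_ext => w; rewrite cat_cons mem_cat_consl.
rewrite !big_seq; apply: eq_bigr => e /(allP C'm) em.
rewrite subtree_from_consr //; congr (ucm (rtree_of _)).
by apply: root_component_ext => w; rewrite mem_cat_consr //; case: (e) em.
Qed.

Lemma roots_cons m u s C C' : all (head_ge m.+1) C' ->
  forest_of (roots_from m (u :: s) (mem (map (cons m) C ++ C')))
    = mmul (root_forest u C) (forest_of (roots_from m.+1 s (mem C'))).
Proof.
move=> C'm; rewrite roots_from_cons /forest_of big_cat /=; congr mmul.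
  rewrite mem_cat_consl // /root_forest; case: ifP => _; first by rewrite big_nil.
  rewrite big_seq1; congr (ucm (rtree_of _)).
  by apply: root_component_ext => w /=; rewrite mem_cat_consl.
suff -> : roots_from m.+1 s (mem (map (cons m) C ++ C')) = roots_from m.+1 s (mem C') by [].
apply: roots_from_ext => [i _ c d cd|v vm]; first exact: root_component_ext.
exact: mem_cat_consr.
Qed.

(** Vertices of different trees start with different positions, so a cut of the forest is an
    independent choice of cuts in its trees, and the sum factors. *)
Lemma forest_cuts_cons m u s :
  forest_cuts m (u :: s) = tree_cuts u * forest_cuts m.+1 s.
Proof.
rewrite /forest_cuts vertices_from_cons big_mkcond big_sublists_cat sublists_map.
rewrite big_map /tree_cuts [X in X * _]big_mkcond mulr_suml.
apply: eq_bigr => C _; rewrite [X in _ * X]big_mkcond mulr_sumr.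
rewrite !big_seq; apply: eq_bigr => C' /sublists_sub C's.
have C'm : all (head_ge m.+1) C'.
  by apply/allP => v /C's /(allP (head_ge_vertices_from m.+1 s)).
rewrite crosses_once_cons //.
case: ifP => [/andP[-> ->]|/negbT]; last first.
  by rewrite negb_and => /orP[]/negbTE->; rewrite ?mul0r ?mulr0.
by rewrite pruned_by_cons // roots_cons // mon_pairM.
Qed.

Lemma forest_cutsE m s : forest_cuts m s = \prod_(u <- s) tree_cuts u.
Proof.
elim: s m => [|u s IH] m; last by rewrite big_cons forest_cuts_cons IH.
rewrite big_nil /forest_cuts /= big_mkcond big_seq1.
by rewrite /pruned_by /forest_of !big_nil mon1.
Qed.

Definition root_preserving_cuts u : H2 :=
  \sum_(C <- sublists (edges u) | crosses_once (leaves u) C)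
     mon K (pruned_by (subtree u) C, ucm (rtree_of (root_component u (mem C)))).

(** Cuts are split according to whether the root is cut. If it is, [leaf_below] forbids any other
    edge. *)
Lemma tree_cutsE u :
  tree_cuts u = mon K (ucm (rtree_of u), mone) + root_preserving_cuts u.
Proof.
rewrite /tree_cuts vertices_edges big_sublists_cons; apply: congr_add.
  rewrite big_sublists_nil.
  - rewrite /root_forest mem_head /pruned_by big_seq1 root_component_uncut //.
    by case.
  - exact: edges_uniq.
  - case=> // e C _ Cu /allP crossC.
    have /leaf_below[l lu el] : e \in vertices u.
      by rewrite vertices_edges inE (Cu e (mem_head _ _)) orbT.
    by have := crossC l lu; rewrite /= prefix0s el.
  - by apply/allP => l _ /=; case: prefix.
apply: eq_sum_seq => C /sublists_sub Cu; first by [].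
rewrite /root_forest ifN //; apply/negP => /Cu.
by rewrite mem_filter eqxx.
Qed.

(** A cut of a grafted tree that spares the root is a cut of the forest of its children: removing
    the edge above a child amounts to cutting that child at its root. This is the combinatorial form
    of the cocycle property. *)
Lemma root_preserving_cuts_node s :
  root_preserving_cuts (PNode s)
    = lextend (fun p => mon K (p.1, ucm (graft p.2))) (\prod_(u <- s) tree_cuts u).
Proof.
rewrite -(forest_cutsE 0) /root_preserving_cuts /forest_cuts edges_node.
rewrite linear_sum; apply: eq_sum_seq => C /sublists_sub Cs; last first.
  rewrite /= lextend_mon /= graft_forest_of; apply: mon_congr; last by [].
  rewrite /pruned_by !big_seq; apply: eq_bigr => e /Cs es.
  rewrite subtree_node //.
  by move: (allP (head_ge_vertices_from 0 s) e es); case: (e).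
(* In the one-vertex tree the root is itself a leaf, so [leaves_node] does not apply; the only cut
   is then the empty one. *)
have [s0|/leaves_node -> //] := eqVneq s [::].
by case: C Cs => [|e C]; [rewrite /crosses_once !all_predT | rewrite s0 => /(_ e (mem_head _ _))].
Qed.

Lemma sum_admissible_cuts u :
  seal (\sum_(c : cut u | admissible c) << (pruned c, ucm (trunk c)) >>)
    = root_preserving_cuts u.
Proof.
rewrite linear_sum /= /root_preserving_cuts big_mkcond [RHS]big_mkcond.
rewrite -(sum_values (edges_uniq u)); apply: eq_bigr => c _.
have perm_c := perm_values (edges_uniq u) c.
have in_cutE v : in_cut c v = (v \in values c) by rewrite /in_cut (perm_mem perm_c).
have -> : admissible c = crosses_once (leaves u) (values c).
  apply: eq_all => l; rewrite -(permP perm_c) count_map; congr (_ <= _)%N.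
  by rewrite -size_filter cardE; congr size; rewrite /enum_mem -filter_predI;
     apply: eq_filter => e; rewrite /= !inE andbC.
case: crosses_once; last by [].
rewrite -monE.
apply: (@mon_congr (pruned c) _ (ucm (trunk c))).
  rewrite /pruned /pruned_by -(perm_big _ perm_c) big_image /=.
  apply: eq_bigr => e _; congr (ucm (rtree_of _)).
  by apply: root_component_ext => w; rewrite in_cutE.
by congr (ucm (rtree_of _)); apply: root_component_ext => w; rewrite in_cutE.
Qed.

Definition cop_tree (T : rtree) : H2 := seal (coproduct_tree K T).

(** The two primitive terms of the coproduct are cuts as well: [T (x) 1] comes from the cut at the
    root and [1 (x) T] from the empty cut. *)
Lemma cop_tree_cuts T : cop_tree T = tree_cuts (val T).
Proof.
rewrite tree_cutsE -sum_admissible_cuts (bigD1 set0) /=; last first.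
  apply/allP => l _; rewrite (_ : [set e in set0 | _] = set0) ?cards0 //.
  by apply/setP => e; rewrite !inE.
apply: (etrans (sealDA _ _ _)); rewrite rtree_of_val; apply: congr_add; first by rewrite monE.
apply: (congr1 (@seal K _)); apply: congr_add; last by apply: eq_bigl => c; rewrite andbC.
apply: (congr1 (fun p => << p >>)); apply: (congr2 pair).
  by rewrite /pruned big_set0.
apply: (congr1 (@ucm _)); rewrite /trunk /component root_component_uncut.
  by rewrite rtree_of_val.
by move=> v _; apply/imageP => -[e]; rewrite inE.
Qed.

(** The cocycle property on trees. Together with multiplicativity it determines the coproduct, and
    cuts do not appear again after it. *)
Lemma cop_tree_rec T :
  cop_tree T = mon K (ucm T, mone)
    + lextend (fun p => mon K (p.1, ucm (graft p.2))) (prodm cop_tree (ungraft T)).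
Proof.
rewrite cop_tree_cuts tree_cutsE rtree_of_val; apply: congr_add; first by [].
case: T => -[l] lcan; rewrite root_preserving_cuts_node.
apply: (congr1 (lextend _)).
rewrite /ungraft /= /forest_of (big_morph _ (prodmM _) (prodm1 _)).
rewrite big_seq [RHS]big_seq; apply: eq_bigr => u lu.
rewrite prodmU cop_tree_cuts /= canon_id //.
by move: lcan => /= /andP[_ /allP]; apply; apply: map_f.
Qed.

Lemma cop_tree_graft f :
  cop_tree (graft f) = mon K (ucm (graft f), mone)
    + lextend (fun p => mon K (p.1, ucm (graft p.2))) (prodm cop_tree f).
Proof. by rewrite cop_tree_rec graftK. Qed.

End CutSums.

(** * The coproduct *)

Section MonomialAlgebra.
Context (K : fieldType) (M N : conomType).

Lemma coefM_neq0 (x y : smalg K M) k : coef k (x * y) != 0 ->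
  exists k1 k2, [/\ coef k1 x != 0, coef k2 y != 0 & k = mmul k1 k2].
Proof.
rewrite -{1}[x]unsealK -{1}[y]unsealK -rmorphM coef_seal mcoeff_neq0.
case/msuppM_le => k1 [k2 [k1x k2y ->]]; exists k1, k2.
by rewrite !fcoefE !mcoeff_neq0.
Qed.

(** Cancellation of [k] is a hypothesis because a commutative monoid of type [conomType] may fail to
    be cancellative. *)
Lemma coef_monM (z : smalg K M) k l :
  (forall l', mmul k l' = mmul k l -> l' = l) ->
  coef (mmul k l) (mon K k * z) = coef l z.
Proof.
move=> kl; elim/smalg_ind: z => [|c l' z IH]; first by rewrite mulr0 !fcoef0.
rewrite mulPr !fcoefPl IH -monM !coef_mon.
suff -> : (mmul k l' == mmul k l) = (l' == l) by [].
by apply/eqP/eqP => [/kl|->].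
Qed.

Lemma coef_lextend_mon (phi : M -> N) (x : smalg K M) k : injective phi ->
  coef (phi k) (lextend (fun k => mon K (phi k)) x) = coef k x.
Proof.
move=> phi_inj; elim/smalg_ind: x => [|c l x IH]; first by rewrite linear0 !fcoef0.
by rewrite linearP !fcoefPl /= IH lextend_mon !coef_mon (inj_eq phi_inj).
Qed.

Lemma coef_lextend_neq0 (phi : M -> N) (x : smalg K M) l :
  coef l (lextend (fun k => mon K (phi k)) x) != 0 ->
  exists2 k, coef k x != 0 & phi k = l.
Proof.
have [/hasP[k kx /eqP kl] _|/hasPn phil] := boolP (has (fun k => phi k == l) (support x)).
  by exists k; rewrite // -supportP.
rewrite lextendE fcoef_sum big1_seq ?eqxx // => k /andP[_ /phil/negbTE kl].
by rewrite fcoefZ coef_mon kl mulr0.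
Qed.

End MonomialAlgebra.

Lemma cm_cancel (I : choiceType) (m n n' : {cmonom I}) :
  mmul m n = mmul m n' -> n = n'.
Proof.
move/eqP/cmP => mn; apply/eqP/cmP => i; apply/eqP.
by rewrite -(eqn_add2l (m i)) -!cmM mn.
Qed.

Lemma ucm_inj (I : choiceType) : injective (@ucm I).
Proof.
move=> i j /eqP/cmP/(_ j); rewrite !cmU eqxx.
by case: eqP.
Qed.

Lemma cm_divisor (I : choiceType) (i : I) (m : {cmonom I}) :
  (0 < m i)%N -> exists n, m = mmul (ucm i) n.
Proof.
move=> mi; exists (divcm m (ucm i)); apply/eqP/cmP => j.
by rewrite cmM divcmE cmU subnKC //; case: eqVneq => //= <-.
Qed.

Lemma mmul_ucm_eq (I : choiceType) (i j : I) (m n : {cmonom I}) :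
  mmul (ucm i) m = mmul (ucm j) n -> i != j ->
  exists k, m = mmul (ucm j) k /\ n = mmul (ucm i) k.
Proof.
move=> mn ij; have /cm_divisor[k nk] : (0 < n i)%N.
  by move/eqP/cmP/(_ i): mn; rewrite !cmM !cmU eqxx eq_sym (negbTE ij) /= add0n => <-.
exists k; split=> //; apply: (@cm_cancel _ (ucm i)).
by rewrite mn nk !mulmA (mulmC (ucm j)).
Qed.

(** A tree is the grafting of a forest with one vertex less, so size allows an induction through
    products and grafting, the two operations on which the coproduct is known. *)
Lemma forest_ind (P : forest -> Prop) :
  P mone -> (forall T f, P (ucm T) -> P f -> P (mmul (ucm T) f)) ->
  (forall f, P f -> P (ucm (graft f))) -> forall f, P f.
Proof.
move=> P1 PM PB f; have [n] := ubnP (forest_size f).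
elim: n f => // n IH f; rewrite ltnS => fn.
elim/cmonom_ind: f fn => // T f IHf; rewrite forest_sizeM forest_sizeU => fn.
apply: PM; last by apply/IHf/(leq_trans _ fn)/leq_addl.
rewrite -(ungraftK T); apply/PB/IH/(leq_trans _ fn).
by rewrite -{2}(ungraftK T) tree_size_graft leq_addr.
Qed.

Section Coproduct.
Context (K : fieldType).
Local Notation H := (smalg K forest).
Local Notation H2 := (smalg K (forest * forest)%type).
Local Notation cop := (prodm (cop_tree K)).
Implicit Types (f g h : forest) (x y : H) (z : H2).

Definition Delta (x : H) : H2 := lextend cop x.
HB.instance Definition _ := GRing.isLinear.Build K H H2 *:%R Delta
  (@lextend_is_linear _ _ _ _).

Definition grafting (x : H) : H := lextend (fun f => mon K (ucm (graft f))) x.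
HB.instance Definition _ := GRing.isLinear.Build K H H *:%R grafting
  (@lextend_is_linear _ _ _ _).

(** The map [id (x) B_+]. *)
Definition graft_right (z : H2) : H2 :=
  lextend (fun p => mon K (p.1, ucm (graft p.2))) z.
HB.instance Definition _ := GRing.isLinear.Build K H2 H2 *:%R graft_right
  (@lextend_is_linear _ _ _ _).

Lemma Delta_mon f : Delta (mon K f) = cop f. Proof. exact: lextend_mon. Qed.

Lemma DeltaM x y : Delta (x * y) = Delta x * Delta y.
Proof. exact: lextendM (prodmM _) _ _. Qed.

Lemma Delta1 : Delta 1 = 1.
Proof. by rewrite -mon1 Delta_mon prodm1. Qed.

Lemma grafting_mon f : grafting (mon K f) = mon K (ucm (graft f)).
Proof. exact: lextend_mon. Qed.

Lemma coef_grafting f x : coef (ucm (graft f)) (grafting x) = coef f x.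
Proof.
apply: (coef_lextend_mon (phi := fun f => ucm (graft f))).
by move=> ? ? /ucm_inj/graft_inj.
Qed.

Lemma grafting_inj : injective grafting.
Proof.
by move=> x y xy; apply: fcoefP => f; rewrite -coef_grafting xy coef_grafting.
Qed.

Lemma coef_graft_right g h z :
  coef (g, ucm (graft h)) (graft_right z) = coef (g, h) z.
Proof.
apply: (coef_lextend_mon (phi := fun p => (p.1, ucm (graft p.2))) z (g, h)).
by move=> [? ?] [? ?] /= [-> /ucm_inj/graft_inj ->].
Qed.

Lemma coef_graft_right_neq0 g h z : coef (g, h) (graft_right z) != 0 ->
  exists2 h', h = ucm (graft h') & coef (g, h') z != 0.
Proof.
move/(coef_lextend_neq0 (phi := fun p => (p.1, ucm (graft p.2)))).
by case=> -[g' h'] /= + [<- <-]; exists h'.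
Qed.

Lemma coef_graft_right_one g z : coef (g, mone) (graft_right z) = 0.
Proof.
apply/eqP/negPn/negP => /coef_graft_right_neq0[h' /esym/eqP].
by rewrite cm1_eq1.
Qed.

Lemma graft_right_tensor x y : graft_right (tensor x y) = tensor x (grafting y).
Proof.
elim/smalg_ind: x => [|c f x IH]; first by rewrite !tensor0l linear0.
rewrite tensorPl linearP /= IH tensorPl; congr (_ *: _ + _) => {IH}.
elim/smalg_ind: y => [|d g y IH]; first by rewrite !(linear0, tensor0r).
rewrite tensorPr !linearP /= IH; congr (_ *: _ + _).
by rewrite tensor_mon grafting_mon tensor_mon [LHS]lextend_mon.
Qed.

Lemma cop_graft f :
  cop (ucm (graft f)) = mon K (ucm (graft f), mone) + graft_right (cop f).
Proof. by rewrite prodmU cop_tree_graft. Qed.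

Lemma Delta_grafting x :
  Delta (grafting x) = tensor (grafting x) 1 + graft_right (Delta x).
Proof.
elim/smalg_ind: x => [|c f x IH]; first by rewrite !linear0 tensor0l addr0.
rewrite !linearP /= tensorPl IH [RHS]addrACA -scalerDr; congr (_ *: _ + _).
rewrite grafting_mon.
rewrite !Delta_mon.
rewrite cop_graft.
rewrite -mon1.
by rewrite tensor_mon.
Qed.

(** The map [epsilon (x) id], where [epsilon] is the counit; [counit_right] is [id (x) epsilon]. *)
Definition counit_left (z : H2) : H :=
  lextend (fun p => if p.1 == mone then mon K p.2 else 0) z.
HB.instance Definition _ := GRing.isLinear.Build K H2 H *:%R counit_left
  (@lextend_is_linear _ _ _ _).

Definition counit_right (z : H2) : H :=
  lextend (fun p => if p.2 == mone then mon K p.1 else 0) z.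
HB.instance Definition _ := GRing.isLinear.Build K H2 H *:%R counit_right
  (@lextend_is_linear _ _ _ _).

Lemma counit_leftM z w : counit_left (z * w) = counit_left z * counit_left w.
Proof.
apply: lextendM => -[f g] [f' g'] /=; rewrite cmM_eq1.
by case: eqP => _; case: eqP => _ /=; rewrite ?mul0r ?mulr0 ?monM.
Qed.

Lemma counit_rightM z w : counit_right (z * w) = counit_right z * counit_right w.
Proof.
apply: lextendM => -[f g] [f' g'] /=; rewrite cmM_eq1.
by case: eqP => _; case: eqP => _ /=; rewrite ?mul0r ?mulr0 ?monM.
Qed.

Lemma coef_counit_left h z : coef h (counit_left z) = coef (mone, h) z.
Proof.
elim/smalg_ind: z => [|c [f g] z IH]; first by rewrite linear0 !fcoef0.
rewrite linearP !fcoefPl /= IH /counit_left lextend_mon /= !coef_mon xpair_eqE.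
by case: eqP => _; rewrite ?coef_mon ?fcoef0.
Qed.

Lemma coef_counit_right h z : coef h (counit_right z) = coef (h, mone) z.
Proof.
elim/smalg_ind: z => [|c [f g] z IH]; first by rewrite linear0 !fcoef0.
rewrite linearP !fcoefPl /= IH /counit_right lextend_mon /= !coef_mon xpair_eqE andbC.
by case: eqP => _; rewrite ?coef_mon ?fcoef0.
Qed.

Lemma counit_left_graft_right z :
  counit_left (graft_right z) = grafting (counit_left z).
Proof.
elim/smalg_ind: z => [|c [f g] z IH]; first by rewrite !linear0.
rewrite !linearP /= IH /graft_right /counit_left !lextend_mon /=.
by case: eqP => _; rewrite ?grafting_mon ?linear0.
Qed.

Lemma counit_left_cop f : counit_left (cop f) = mon K f.
Proof.
elim/forest_ind: f => [|T f IHT IHf|f IH].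
- by rewrite prodm1 -!mon1 /counit_left lextend_mon /= eqxx.
- by rewrite prodmM counit_leftM IHT IHf monM.
rewrite cop_graft linearD /= {1}/counit_left lextend_mon /= cm1_eq1 add0r.
by rewrite counit_left_graft_right IH grafting_mon.
Qed.

Lemma counit_right_cop f : counit_right (cop f) = mon K f.
Proof.
elim/forest_ind: f => [|T f IHT IHf|f IH].
- by rewrite prodm1 -!mon1 /counit_right lextend_mon /= eqxx.
- by rewrite prodmM counit_rightM IHT IHf monM.
rewrite cop_graft linearD /= {1}/counit_right lextend_mon /= eqxx.
rewrite [X in _ + X](_ : _ = 0) ?addr0 //.
by apply: fcoefP => h; rewrite coef_counit_right coef_graft_right_one fcoef0.
Qed.

Lemma coef_cop_onel f h : coef (mone, h) (cop f) = (f == h)%:R.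
Proof. by rewrite -coef_counit_left counit_left_cop coef_mon. Qed.

Lemma coef_cop_oner f g : coef (g, mone) (cop f) = (f == g)%:R.
Proof. by rewrite -coef_counit_right counit_right_cop coef_mon. Qed.

Lemma coef_Delta_oner x g : coef (g, mone) (Delta x) = coef g x.
Proof.
elim/smalg_ind: x => [|c f x IH]; first by rewrite linear0 !fcoef0.
by rewrite linearP !fcoefPl /= IH Delta_mon coef_cop_oner coef_mon.
Qed.

Lemma cop_degree f g h : coef (g, h) (cop f) != 0 ->
  (forest_size g + forest_size h)%N = forest_size f.
Proof.
elim/forest_ind: f g h => [|T f IHT IHf|f IH] g h.
- rewrite prodm1 -mon1 coef_mon (xpair_eqE mone g mone h).
  case: (mone =P g) => [<-|_]; case: (mone =P h) => [<-|_]; rewrite ?eqxx //.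
  by rewrite forest_size1.
- rewrite prodmM => /coefM_neq0[[g1 h1] [[g2 h2] [/IHT e1 /IHf e2 [-> ->]]]].
  by rewrite !forest_sizeM -e1 -e2 addnACA.
rewrite cop_graft fcoefD coef_mon; have [<-|h1] := eqVneq mone h.
  rewrite coef_graft_right_one addr0 xpair_eqE eqxx andbT.
  by case: (_ =P g) => [<- _|]; rewrite ?eqxx // forest_size1 addn0.
rewrite xpair_eqE (negbTE h1) andbF add0r.
case/coef_graft_right_neq0=> h' -> /IH.
by rewrite !forest_sizeU !tree_size_graft addnS => ->.
Qed.

Lemma Delta_degree x f g : coef (f, g) (Delta x) != 0 ->
  exists2 h, coef h x != 0 & (forest_size f + forest_size g)%N = forest_size h.
Proof.
rewrite /Delta lextendE fcoef_sum.
have [/hasP[h]|/hasPn x0] :=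
    boolP (has (fun h => coef (f, g) (cop h) != 0) (support x)).
  by rewrite supportP => hx /cop_degree e _; exists h.
rewrite big1_seq ?eqxx // => h /andP[_ /x0].
by rewrite negbK fcoefZ => /eqP ->; rewrite mulr0.
Qed.

(* Up to forests with at least as many trees, detaching one copy of [T] acts as
   the partial derivative with respect to [T]. *)
Lemma coef_cop_tree f T h : (mdeg h < mdeg f)%N ->
  coef (ucm T, h) (cop f) = (if f == mmul (ucm T) h then (f T)%:R else 0).
Proof.
elim/cmonom_ind: f h => [|t f IH] h; first by rewrite mdeg1.
rewrite mdegM mdegU add1n ltnS => hf; rewrite prodmM.
(* [S] is the reduced coproduct of [t]: both factors of each of its terms are nonempty forests. *)
pose S := cop (ucm t) - (mon K (ucm t, mone) + mon K (mone, ucm t)).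
have SE : cop (ucm t) = mon K (ucm t, mone) + mon K (mone, ucm t) + S.
  by rewrite /S addrC subrK.
(* The nonempty left factor coming from [S] uses up the single tree [T], so [f] goes to the right as
   a whole, next to a nonempty forest. This gives more than [mdeg f] trees, too many for [h]. *)
have S0 : coef (ucm T, h) (S * cop f) = 0.
  apply/eqP/negPn/negP => /coefM_neq0[[g1 h1] [[g2 h2] [e1 e2 [Tg hh]]]].
  have g11 : g1 != mone.
    apply/negP => /eqP g1E; move: e1; rewrite g1E fcoefB fcoefD coef_cop_onel !coef_mon.
    by rewrite !xpair_eqE cm1_eq1 eqxx add0r subrr eqxx.
  have h11 : h1 != mone.
    apply/negP => /eqP h1E; move: e1; rewrite h1E fcoefB fcoefD coef_cop_oner !coef_mon.
    by rewrite !xpair_eqE cm1_eq1 eqxx andbT andbF addr0 subrr eqxx.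
  have g21 : g2 = mone.
    apply: mdeg_eq0I; move: (mdegU T); rewrite Tg mdegM.
    move: g11; rewrite -mdeg_eq0; case: (mdeg g1) => [//|n] _ /eqP.
    by rewrite addSn eqSS addn_eq0 => /andP[_ /eqP].
  move: e2; rewrite g21 coef_cop_onel; case: (f =P h2) => [f2 _|]; last by rewrite eqxx.
  by move: hf; rewrite hh mdegM -f2 -{2}[mdeg f]add0n leq_add2r leqn0 mdeg_eq0 (negbTE h11).
rewrite SE mulrDl fcoefD S0 addr0 mulrDl fcoefD.
(* The two remaining terms are those of the Leibniz rule: here the factor [t] is differentiated,
   below the factor [f]. *)
have -> : coef (ucm T, h) (mon K (ucm t, mone) * cop f) = ((f == h) && (t == T))%:R.
  have [->|tT] := eqVneq t T; rewrite ?andbT ?andbF /=.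
    rewrite -{1}(mulm1 (ucm T)) -{1}(mul1m h).
    rewrite (coef_monM _ (k := (ucm T, mone)) (l := (mone, h))) ?coef_cop_onel //.
    by move=> [? ?] [/cm_cancel -> /cm_cancel ->].
  apply/eqP/negPn/negP => /coefM_neq0[[g1 h1] [[g2 h2] [e1 _ [Tg _]]]].
  move: e1; rewrite coef_mon xpair_eqE; case: (ucm t =P g1) => [tg _|_]; last by rewrite eqxx.
  by move/eqP/cmP/(_ t): Tg; rewrite -tg cmM !cmU eqxx (eq_sym T) (negbTE tT).
have [/cm_divisor[h' hE]|] := ltnP 0 (h t).
  have -> : coef (ucm T, h) (mon K (mone, ucm t) * cop f) = coef (ucm T, h') (cop f).
    rewrite hE -{1}(mul1m (ucm T)).
    apply: (coef_monM _ (k := (mone, ucm t)) (l := (ucm T, h'))).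
    by move=> [? ?] [/cm_cancel -> /cm_cancel ->].
  rewrite IH; last by move: hf; rewrite hE mdegM mdegU.
  have -> : (mmul (ucm t) f == mmul (ucm T) h) = (f == mmul (ucm T) h').
    rewrite hE mulmA (mulmC (ucm T)) -mulmA.
    by apply/eqP/eqP => [/cm_cancel|->].
  have -> : (f == h) && (t == T) = (t == T) && (f == mmul (ucm T) h').
    rewrite hE andbC; case: (t =P T) => [->|_]; last exact: andFb.
    exact: erefl.
  case: (f =P _) => _; last by rewrite andbF addr0.
  by rewrite andbT cmM cmU natrD.
rewrite leqn0 => /eqP ht0.
have -> : coef (ucm T, h) (mon K (mone, ucm t) * cop f) = 0.
  apply/eqP/negPn/negP => /coefM_neq0[[g1 h1] [[g2 h2] [e1 _ [_ hh]]]].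
  move: e1; rewrite coef_mon xpair_eqE; case: (ucm t =P h1) => [th|_]; last by rewrite andbF eqxx.
  by move: ht0; rewrite hh -th cmM cmUU.
rewrite addr0; have [tT|tT] := eqVneq t T; rewrite ?andbT ?andbF.
  have -> : (mmul (ucm t) f == mmul (ucm T) h) = (f == h).
    by rewrite tT; apply/eqP/eqP => [/cm_cancel|->].
  by case: (f =P h) => [->|//]; rewrite cmM -tT ht0 cmUU.
rewrite ifN //; apply/negP => /eqP/mmul_ucm_eq/(_ tT)[k [_ hk]].
by move: ht0; rewrite hk cmM cmUU.
Qed.

(** Among forests with at least two trees, [coef_cop_tree] leaves only [T T'], with coefficient the
    multiplicity of [T] in it. The multiplicities of [T] and [T'] there agree: both are 2 if
    [T = T'] and 1 otherwise. *)
Lemma coef_Delta_swap x T T' : (forall U, coef (ucm U) x = 0) ->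
  coef (ucm T, ucm T') (Delta x) = coef (ucm T', ucm T) (Delta x).
Proof.
move=> x0; rewrite /Delta lextendE !fcoef_sum; apply: eq_big_seq => f.
rewrite supportP !fcoefZ => fx.
case: (ltngtP (mdeg f) 1) => [|f1|f1].
- rewrite ltnS leqn0 mdeg_eq0 => /eqP ->.
  by rewrite prodm1 -mon1 !coef_mon !(xpair_eqE mone _ mone) !(eq_sym mone) !cm1_eq1.
- rewrite !coef_cop_tree ?mdegU // (mulmC (ucm T')); case: eqP => // ->.
  by rewrite !cmM !cmUU !cmU addnC eq_sym.
move: fx; elim/cmonom_ind: f f1 => [|U f _]; first by rewrite mdeg1.
rewrite mdegM mdegU => -[/mdeg_eq0I ->].
by rewrite mulm1 x0 eqxx.
Qed.

(** Vanishing partial derivatives force [x] to be constant. By induction on the number of trees, the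
    forests with fewer trees than [f = T h] do not occur in [x], so the coefficient of [(T, h)] is
    that of [f] times the multiplicity of [T], which is invertible in characteristic zero. *)
Lemma Delta_trees_eq0 (charK : [pchar K] =i pred0) x :
  coef mone x = 0 -> (forall T h, coef (ucm T, h) (Delta x) = 0) -> x = 0.
Proof.
move=> x1 xT; apply: fcoefP => f; rewrite fcoef0.
have [n] := ubnP (mdeg f); elim: n f => // n IH f; rewrite ltnS => fn.
have [->//|/cmonom_neq1P[T [h fE]]] := eqVneq f mone.
have : coef f x * (f T)%:R = 0.
  rewrite -(xT T h) /Delta lextendE fcoef_sum.
  have fh : (mdeg h < mdeg f)%N by rewrite fE mdegM mdegU.
  rewrite -sum_support_delta; apply/esym; apply: eq_big_seq => g.
  rewrite supportP fcoefZ => gx; rewrite coef_cop_tree -?fE.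
    by case: eqP => // ->.
  apply: leq_trans fh _; rewrite leqNgt; apply: contra gx => gf.
  by rewrite IH // (leq_trans gf).
move/eqP; rewrite mulf_eq0 => /orP[/eqP//|].
move/pcharf0P: charK => ->; rewrite fE cmM cmUU.
by [].
Qed.

End Coproduct.

(** * Sequences of order zero *)

Section Boundary.
Context (K : fieldType).
Local Notation H := (smalg K forest).

Lemma seal_coproduct (x : HCK K) : seal (coproduct x) = Delta (seal x).
Proof.
rewrite /Delta lextend_seal lextE linear_sum; apply: eq_bigr => f _.
rewrite linearZ; apply: (congr1 (fun z => _ *: z)).
by rewrite /= rmorph_prod prodmE; apply: eq_bigr => T _; rewrite rmorphXn.
Qed.

Lemma seal_tree T : seal (tree K T) = mon K (ucm T).
Proof. by rewrite monE. Qed.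

Lemma seal_Bplus (x : HCK K) : seal (Bplus x) = grafting (seal x).
Proof.
rewrite /grafting lextend_seal lextE linear_sum; apply: eq_bigr => f _.
by rewrite linearZ /= seal_tree.
Qed.

Definition monomial (s : nat -> H) (m : {cmonom nat}) : H :=
  prodm (fun n => s n.+1) m.

Lemma seal_seq_monomial (t : nat -> HCK K) m :
  seal (seq_monomial t m) = monomial (fun n => seal (t n)) m.
Proof.
rewrite /seq_monomial /monomial prodmE rmorph_prod; apply: eq_bigr => n _.
by rewrite rmorphXn.
Qed.

Lemma seal_seq_tensor (t : nat -> HCK K) P :
  seal (seq_tensor t P)
    = lextend (fun p => tensor (monomial (fun n => seal (t n)) p.1)
                               (monomial (fun n => seal (t n)) p.2)) (seal P).
Proof.
rewrite lextend_seal lextE linear_sum; apply: eq_bigr => p _.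
by rewrite linearZ /= seal_tens !seal_seq_monomial.
Qed.

End Boundary.

Section ZerothOrder.
Context (K : fieldType).
Local Notation H := (smalg K forest).
Implicit Types (a : nat -> K) (s : nat -> H).

Definition tree_sequence s : Prop :=
  forall n f, (0 < n)%N -> coef f (s n) != 0 ->
    exists2 T, f = ucm T & tree_size T = n.

Definition dot : rtree := graft mone.

(* [lambda i j = a j], read off the coefficients of pairs of trees. *)
Definition zeroth_order a s : Prop :=
  [/\ s 1%N = mon K (ucm dot), tree_sequence s
    & forall T T', coef (ucm T, ucm T') (Delta (s (tree_size T' + tree_size T)%N))
        = a (tree_size T) * (coef (ucm T) (s (tree_size T))
                             * coef (ucm T') (s (tree_size T')))].

Lemma coef_tree_sequence s n T : tree_sequence s -> (0 < n)%N ->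
  tree_size T != n -> coef (ucm T) (s n) = 0.
Proof.
move=> st n0 Tn; apply/eqP/negPn/negP => /(st _ _ n0)[U /ucm_inj <- Un].
by rewrite Un eqxx in Tn.
Qed.

Lemma coef1_tree_sequence s n : tree_sequence s -> (0 < n)%N ->
  coef mone (s n) = 0.
Proof.
move=> st n0; apply/eqP/negPn/negP => /(st _ _ n0)[U /esym/eqP].
by rewrite cm1_eq1.
Qed.

Lemma tree_sequence_neq0 s n : tree_sequence s -> (0 < n)%N -> s n != 0 ->
  exists2 T, tree_size T = n & coef (ucm T) (s n) != 0.
Proof.
move=> st n0 sn; have [|/hasPn s0] := boolP (has predT (support (s n))).
  case/hasP => f; rewrite supportP => fs _; have [T fT Tn] := st n f n0 fs.
  by exists T; rewrite // -fT.
case/eqP: sn; apply: fcoefP => f; rewrite fcoef0; apply/eqP/negPn/negP.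
by rewrite -supportP => /s0.
Qed.

Lemma coef1_monomial s m : tree_sequence s -> m != mone ->
  coef mone (monomial s m) = 0.
Proof.
move=> st /cmonom_neq1P[i [n ->]]; apply/eqP/negPn/negP.
rewrite /monomial prodmM prodmU => /coefM_neq0[k1 [k2 [k1s _ /esym/eqP]]].
rewrite cmM_eq1 => /andP[/eqP k11 _].
by rewrite k11 coef1_tree_sequence ?eqxx in k1s.
Qed.

(** Each [s n] is a combination of trees, so a product of two or more of them contains only forests
    with at least two trees; a single tree can come only from the variable of its own size. *)
Lemma coef_tree_monomial s T m : tree_sequence s ->
  coef (ucm T) (monomial s m)
    = if m == ucm (tree_size T).-1 then coef (ucm T) (s (tree_size T)) else 0.
Proof.
move=> st; have [->|/cmonom_neq1P[i [n ->]]] := eqVneq m mone.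
  rewrite /monomial prodm1 -mon1 coef_mon !(eq_sym mone).
  by rewrite !cm1_eq1.
rewrite /monomial prodmM prodmU; have [->|n1] := eqVneq n mone.
  rewrite prodm1 mulr1 mulm1; case: eqP => [/ucm_inj ->|iT].
    by rewrite prednK // tree_size_gt0.
  rewrite coef_tree_sequence //; apply/eqP => Ti; case: iT; congr ucm.
  by rewrite Ti.
rewrite ifN; last first.
  apply: contra n1 => /eqP/(congr1 mdeg); rewrite mdegM !mdegU => -[].
  by move/eqP; rewrite mdeg_eq0.
apply/eqP/negPn/negP => /coefM_neq0[k1 [k2 [k1s k2s /(congr1 mdeg)]]].
have [U -> _] := st _ _ (ltn0Sn i) k1s; rewrite mdegM !mdegU => -[].
move/esym/mdeg_eq0I => k21; move: k2s.
by rewrite k21 [coef _ _]coef1_monomial ?eqxx.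
Qed.

Lemma Delta_tree_sequence_degree s n f g : tree_sequence s -> (0 < n)%N ->
  coef (f, g) (Delta (s n)) != 0 -> (forest_size f + forest_size g)%N = n.
Proof.
move=> st n0 /Delta_degree[h /(st _ _ n0)[T -> <-] ->].
exact: forest_sizeU.
Qed.

Lemma grafting_surj (x : H) :
  (forall f, coef f x != 0 -> exists T, f = ucm T) -> exists y, grafting y = x.
Proof.
move=> xT; rewrite [x]smalg_sumE big_seq.
elim/big_rec: _ => [|f z]; first by exists 0; rewrite linear0.
rewrite supportP => /xT[T ->] [y <-].
exists (coef (ucm T) x *: mon K (ungraft T) + y).
by rewrite linearP /= grafting_mon ungraftK.
Qed.

Lemma coef_Delta_grafting f h (y : H) :
  coef (f, ucm (graft h)) (Delta (grafting y)) = coef (f, h) (Delta y).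
Proof.
rewrite Delta_grafting fcoefD coef_graft_right coef_tensor -mon1 coef_mon.
by rewrite eq_sym cm1_eq1 mulr0 add0r.
Qed.

(** Homogeneity settles the case where the sizes do not add up to [m]. Otherwise the last
    coefficient is that of [h] in the preimage of [s (forest_size h).+1] under [grafting], which
    makes the formula a recursion. *)
Lemma zeroth_order_root a s m : zeroth_order a s ->
  exists2 y, grafting y = s m.+1 & forall T h, coef (ucm T, h) (Delta y) =
    if (tree_size T + forest_size h == m)%N
    then a (tree_size T) * (coef (ucm T) (s (tree_size T))
           * coef (ucm (graft h)) (s (forest_size h).+1)) else 0.
Proof.
case=> _ st sa; have [|y ys] := grafting_surj (x := s m.+1).
  by move=> f /(st _ _ (ltn0Sn m))[T -> _]; exists T.
exists y => // T h; rewrite -coef_Delta_grafting ys.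
case: eqP => [<-|Thm].
  by rewrite -(tree_size_graft h) -sa tree_size_graft addSn addnC.
apply/eqP/negPn/negP => /(Delta_tree_sequence_degree st (ltn0Sn m)).
by rewrite !forest_sizeU tree_size_graft addnS => -[].
Qed.

Lemma zeroth_order_uniq (charK : [pchar K] =i pred0) a s s' :
  zeroth_order a s -> zeroth_order a s' -> forall k, (0 < k)%N -> s k = s' k.
Proof.
move=> sa sa' k; have [n] := ubnP k; elim: n k => // n IH [//|m] mn _.
(* The term of rank 1 is prescribed. From rank 2 on, the preimages under [grafting] have no constant
   term, as [Delta_trees_eq0] requires of their difference. *)
case: m mn => [|m] mn; first by case: sa sa' => -> _ _ [-> _ _].
have [y ys yD] := zeroth_order_root m.+1 sa.
have [y' ys' yD'] := zeroth_order_root m.+1 sa'.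
rewrite -ys -ys'; congr grafting; apply/eqP; rewrite -subr_eq0; apply/eqP.
apply: Delta_trees_eq0 => // [|T h].
  rewrite fcoefB -(coef_grafting _ y) -(coef_grafting _ y') ys ys'; case: sa sa' => _ st _ [_ st' _].
  by rewrite !coef_tree_sequence ?subr0 // tree_size_graft forest_size1.
rewrite linearB fcoefB /= yD yD'; case: eqP => [Thm|_]; last by rewrite subr0.
have T0 := tree_size_gt0 T.
rewrite ltnS in mn; have Tn : (tree_size T < n)%N.
  by apply: leq_trans mn; rewrite ltnS -Thm leq_addr.
have hn : ((forest_size h).+1 < n)%N.
  by apply: leq_trans mn; rewrite ltnS -Thm -add1n leq_add2r.
by rewrite !IH ?subrr.
Qed.

(** Let [y] be the preimage of [s (i + j).+1]. Subtracting its tree part [a (i + j) s (i + j)]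
    leaves a decomposable element, on which the coefficients of [(T, T')] and [(T', T)] agree. In
    [Delta y] both carry the factor [a i * a j], so they also agree in
    [a (i + j) Delta (s (i + j))], where they carry the factors [a i] and [a j]. *)
Lemma zeroth_order_relation a s i j : zeroth_order a s ->
  (forall n, (0 < n)%N -> s n != 0) -> (0 < i)%N -> (0 < j)%N ->
  a (i + j)%N * (a i - a j) = 0.
Proof.
move=> sa s0 i0 j0; have [s1 st sD] := sa.
have [T Ti cT] := tree_sequence_neq0 st i0 (s0 i i0).
have [T' Tj cT'] := tree_sequence_neq0 st j0 (s0 j j0).
(* The tree part of [y] is [a m *: s m]: take [h] empty in the recursion, where [graft h] is the
   one-vertex tree and has coefficient 1 in [s 1]. *)
have single m y : grafting y = s m.+1 ->
    (forall T h, coef (ucm T, h) (Delta y) =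
      if (tree_size T + forest_size h == m)%N
      then a (tree_size T) * (coef (ucm T) (s (tree_size T))
             * coef (ucm (graft h)) (s (forest_size h).+1)) else 0) ->
    forall U, (0 < m)%N -> coef (ucm U) y = a m * coef (ucm U) (s m).
  move=> ys yD U m0; rewrite -coef_Delta_oner yD forest_size1 addn0.
  case: eqP => [->|/eqP Um]; last by rewrite coef_tree_sequence // mulr0.
  by rewrite s1 coef_mon eqxx mulr1.
have [y ys yD] := zeroth_order_root (i + j) sa.
have w0 U : coef (ucm U) (y - a (i + j)%N *: s (i + j)%N) = 0.
  by rewrite fcoefB fcoefZ (single _ _ ys yD) ?subrr // addn_gt0 i0.
have := coef_Delta_swap T T' w0.
rewrite linearB linearZ /= !fcoefB !fcoefZ.
(* The recursion gives the factor [a (tree_size U)]; [single], applied one level down, gives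
   [a (tree_size V)]. *)
have yTT U V : (tree_size U + tree_size V)%N = (i + j)%N ->
    coef (ucm U, ucm V) (Delta y) = a (tree_size U) * a (tree_size V)
      * (coef (ucm U) (s (tree_size U)) * coef (ucm V) (s (tree_size V))).
  move=> UV; rewrite yD forest_sizeU UV eqxx.
  have [y' ys' yD'] := zeroth_order_root (tree_size V) sa.
  rewrite -ys' coef_grafting (single _ _ ys' yD') ?tree_size_gt0 //.
  by rewrite -!mulrA; congr (_ * _); rewrite mulrCA.
rewrite !yTT ?Ti ?Tj ?[(j + i)%N]addnC //.
have := sD T T'; rewrite Ti Tj [(j + i)%N]addnC => ->.
have := sD T' T; rewrite Ti Tj => ->.
set c := coef (ucm T) _; set c' := coef (ucm T') _.
rewrite [c' * c]mulrC [a j * a i]mulrC => /addrI/oppr_inj e.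
apply: (mulIf (mulf_neq0 cT cT')).
by rewrite mul0r mulrBr mulrBl -!mulrA e subrr.
Qed.

End ZerothOrder.

(** * Reading the array off pairs of trees *)

Section LambdaArray.
Context (K : fieldType).
Local Notation H := (smalg K forest).

Lemma rtree_of_leaf : rtree_of (PNode [::]) = dot.
Proof. by rewrite /dot -graft_forest_of /forest_of big_nil. Qed.

Lemma coef_tree_combination n (x : HCK K) : tree_combination n x ->
  forall f, coef f (seal x) != 0 -> exists2 T, f = ucm T & tree_size T = n.
Proof.
move=> xn f; rewrite coef_seal mcoeff_neq0 => /xn[T [fT Tn]].
by exists T.
Qed.

Lemma zeroth_order_Lambda (a : nat -> K) (t : nat -> HCK K) lambda :
  in_Seq t -> is_Lambda_array t lambda ->
  (forall i j, (0 < i)%N -> (0 < j)%N -> lambda i j = a j) ->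
  zeroth_order a (fun n => seal (t n)).
Proof.
case=> tn t1 _ tL La.
have st : tree_sequence (fun n => seal (t n)).
  move=> n f n0; have [_ tc] := tn n n0.
  exact: coef_tree_combination tc f.
split=> // [|T T']; first by rewrite t1 seal_tree rtree_of_leaf.
set i := tree_size T'; set j := tree_size T.
have i0 : (0 < i)%N by exact: tree_size_gt0.
have j0 : (0 < j)%N by exact: tree_size_gt0.
have [P [tP lP]] := tL i j i0 j0.
rewrite -(La i j) // lP -seal_coproduct tP seal_seq_tensor lextendE fcoef_sum.
rewrite -[P@_ _]coef_seal -sum_support_delta; apply: eq_bigr => -[m m'] _.
rewrite fcoefZ coef_tensor !coef_tree_monomial //=; apply: (congr1 (fun z => _ * z)).
rewrite xpair_eqE -/i -/j.
by case: (_ =P ucm j.-1); case: (_ =P ucm i.-1); rewrite ?mul0r ?mulr0.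
Qed.

End LambdaArray.

(** * Grouplike series *)

Section Homogeneous.
Context (K : fieldType).
Local Notation H := (smalg K forest).
Implicit Types x y : H.

Definition homogeneous d x : Prop :=
  forall f, coef f x != 0 -> forest_size f = d.

Lemma homogeneous0 d : homogeneous d 0.
Proof. by move=> f; rewrite fcoef0 eqxx. Qed.

Lemma homogeneous1 : homogeneous 0 1.
Proof.
move=> f; rewrite -mon1 coef_mon.
by case: (mone =P f) => [<- _|_]; rewrite ?eqxx // forest_size1.
Qed.

Lemma homogeneousZ d c x : homogeneous d x -> homogeneous d (c *: x).
Proof.
by move=> xd f; rewrite fcoefZ mulf_eq0 negb_or => /andP[_ /xd].
Qed.

Lemma homogeneousD d x y :
  homogeneous d x -> homogeneous d y -> homogeneous d (x + y).
Proof.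
move=> xd yd f; rewrite fcoefD; have [->|/xd //] := eqVneq (coef f x) 0.
by rewrite add0r => /yd.
Qed.

Lemma homogeneousB d x y :
  homogeneous d x -> homogeneous d y -> homogeneous d (x - y).
Proof.
by move=> xd yd; rewrite -scaleN1r; apply/homogeneousD/homogeneousZ.
Qed.

Lemma homogeneousM d e x y :
  homogeneous d x -> homogeneous e y -> homogeneous (d + e) (x * y).
Proof.
move=> xd ye f /coefM_neq0[g [h [/xd <- /ye <- ->]]].
exact: forest_sizeM.
Qed.

Lemma homogeneous_sum d (I : Type) (r : seq I) (Q : pred I) (F : I -> H) :
  (forall i, Q i -> homogeneous d (F i)) ->
  homogeneous d (\sum_(i <- r | Q i) F i).
Proof.
move=> Fd; apply: big_ind => // [|x y]; first exact: homogeneous0.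
exact: homogeneousD.
Qed.

Lemma homogeneousZ_inv d c x : c != 0 -> homogeneous d (c *: x) -> homogeneous d x.
Proof.
by move=> c0 cx f fx; apply: cx; rewrite fcoefZ mulf_neq0.
Qed.

End Homogeneous.

(** * Newton's identities between a series and its logarithm *)

Section Newton.
Context (K : fieldType).
Local Notation H := (smalg K forest).

(* [j *: P j] is the j-th coefficient of the logarithmic derivative of the
   series with coefficients [E j]. *)
Definition newton (A : comAlgType K) (P E : nat -> A) : Prop :=
  forall d, d%:R *: E d = \sum_(j < d.+1) (j%:R *: P j) * E (d - j)%N.

Lemma newton_ext (A : comAlgType K) (P P' E E' : nat -> A) :
  P =1 P' -> E =1 E' -> newton P E -> newton P' E'.
Proof.
move=> PP EE PE d; rewrite -EE PE; apply: eq_bigr => j _.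
by rewrite PP EE.
Qed.

(** Substitution of [c X] for the variable [X] in both series. *)
Lemma newton_scale (A : comAlgType K) (P E : nat -> A) (c : K) : newton P E ->
  newton (fun k => c ^+ k *: P k) (fun k => c ^+ k *: E k).
Proof.
move=> PE d; rewrite scalerA mulrC -scalerA PE scaler_sumr; apply: eq_bigr => j _.
have jd : (j <= d)%N by rewrite -ltnS.
rewrite -!scalerAl -!scalerAr !scalerA -{1}(subnKC jd) exprD.
by congr (_ *: _); rewrite mulrAC (mulrC _ j%:R).
Qed.

Lemma newton_uniq (charK : [pchar K] =i pred0) (A : comAlgType K)
    (P P' E E' : nat -> A) n :
  newton P E -> newton P' E' -> E 0%N = E' 0%N ->
  (forall k, (0 < k < n)%N -> P k = P' k) ->
  forall d, (d < n)%N -> E d = E' d.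
Proof.
move=> PE PE' E0 PP; elim/ltn_ind => -[//|d] IH dn.
apply: (scalerI (a := d.+1%:R)); first by rewrite (pcharf0P K).1.
rewrite PE PE'; apply: eq_bigr => -[[|j] jd] _ /=; first by rewrite !scale0r !mul0r.
rewrite PP; last by rewrite (leq_ltn_trans _ dn).
have dj : (d - j < d.+1)%N by rewrite ltnS leq_subr.
by rewrite subSS IH // (ltn_trans dj dn).
Qed.

(** The logarithmic derivative of the product of the series [E (x) 1] and [1 (x) E] is the sum of
    theirs. *)
Lemma newton_tensor_sum (P E : nat -> H) d :
  newton P E ->
  \sum_(j < d.+1) (j%:R *: (tensor (P j) (1 : H) + tensor (1 : H) (P j)))
     * (\sum_(i < (d - j).+1) tensor (E i) (E (d - j - i)%N))
  = d%:R *: \sum_(i < d.+1) tensor (E i) (E (d - i)%N).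
Proof.
move=> PE.
(* All series are truncated after degree [d]. Up to that degree [A1 * e1] is [X] times the
   derivative of [e1], and likewise for [A2] and [e2]. *)
pose A1 := \poly_(j < d.+1) (j%:R *: tensor (P j) (1 : H)).
pose A2 := \poly_(j < d.+1) (j%:R *: tensor (1 : H) (P j)).
pose e1 := \poly_(j < d.+1) tensor (E j) (1 : H).
pose e2 := \poly_(j < d.+1) tensor (1 : H) (E j).
have e12 n : (n < d.+1)%N ->
    (e1 * e2)`_n = \sum_(i < n.+1) tensor (E i) (E (n - i)%N).
  move=> nd; rewrite coefM; apply: eq_bigr => i _; rewrite !coef_poly.
  rewrite (leq_ltn_trans (leq_subr i n) nd) (leq_trans (ltn_ord i) nd).
  by rewrite tensorM mulr1 mul1r.
have A1e n : (n < d.+1)%N -> (A1 * e1)`_n = n%:R *: tensor (E n) (1 : H).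
  move=> nd; rewrite -tensorZl PE tensor_suml coefM; apply: eq_bigr => i _.
  rewrite !coef_poly (leq_ltn_trans (leq_subr i n) nd) (leq_trans (ltn_ord i) nd).
  by rewrite -tensorZl tensorM mulr1.
have A2e n : (n < d.+1)%N -> (A2 * e2)`_n = n%:R *: tensor (1 : H) (E n).
  move=> nd; rewrite -tensorZr PE tensor_sumr coefM; apply: eq_bigr => i _.
  rewrite !coef_poly (leq_ltn_trans (leq_subr i n) nd) (leq_trans (ltn_ord i) nd).
  by rewrite -tensorZr tensorM mulr1.
transitivity ((A1 * (e1 * e2) + A2 * (e1 * e2))`_d).
  rewrite -mulrDl coefM; apply: eq_bigr => j _.
  rewrite e12 ?ltnS ?leq_subr // coefD !coef_poly ltn_ord.
  by rewrite -scalerDr.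
rewrite coefD mulrA [A2 * _]mulrCA !coefM -big_split scaler_sumr.
apply: eq_bigr => i _ /=; have id1 := ltn_ord i.
have di : (d - i < d.+1)%N by rewrite ltnS leq_subr.
rewrite A1e // A2e // !coef_poly di id1 -scalerAl -scalerAr !tensorM !mulr1 !mul1r.
by rewrite -scalerDl -natrD subnKC // -ltnS.
Qed.

(** The exponential of a primitive series is grouplike: both sides satisfy the same Newton
    recursion. *)
Lemma newton_comultiplicative (charK : [pchar K] =i pred0) (P E : nat -> H) :
  newton P E -> E 0%N = 1 ->
  (forall k, (0 < k)%N -> Delta (P k) = tensor (P k) 1 + tensor 1 (P k)) ->
  forall d, Delta (E d) = \sum_(i < d.+1) tensor (E i) (E (d - i)%N).
Proof.
move=> PE E0 Pprim d; have [n] := ubnP d; elim: n d => // n IH [_|d dn].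
  by rewrite big_ord_recl big_ord0 addr0 subnn E0 tensor11 Delta1.
apply: (scalerI (a := d.+1%:R)); first by rewrite (pcharf0P K).1.
rewrite -(newton_tensor_sum d.+1 PE) -linearZ PE linear_sum; apply: eq_bigr => -[[|j] jd] _ /=.
  by rewrite !scale0r !mul0r linear0.
rewrite DeltaM IH ?linearZ /= ?Pprim // subSS.
by apply: leq_ltn_trans (leq_subr _ _) _; rewrite -ltnS.
Qed.

(** Conversely, the logarithm of a grouplike series is primitive: in Newton's identity of degree [k]
    the terms [j < k] agree by induction, and the term [j = k] has the factor [E 0 = 1]. *)
Lemma newton_primitive (charK : [pchar K] =i pred0) (P E : nat -> H) :
  newton P E -> E 0%N = 1 ->
  (forall d, Delta (E d) = \sum_(i < d.+1) tensor (E i) (E (d - i)%N)) ->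
  forall k, (0 < k)%N -> Delta (P k) = tensor (P k) 1 + tensor 1 (P k).
Proof.
move=> PE E0 Egrp k; have [n] := ubnP k; elim: n k => // n IH [//|k] kn _.
apply: (scalerI (a := k.+1%:R)); first by rewrite (pcharf0P K).1.
have : \sum_(j < k.+2) (j%:R *: Delta (P j)) * Delta (E (k.+1 - j)%N)
    = \sum_(j < k.+2) (j%:R *: (tensor (P j) 1 + tensor 1 (P j)))
        * Delta (E (k.+1 - j)%N).
  transitivity (k.+1%:R *: Delta (E k.+1)).
    rewrite -linearZ PE linear_sum; apply: eq_bigr => j _ /=.
    by rewrite DeltaM linearZ.
  rewrite Egrp -(newton_tensor_sum k.+1 PE).
  by apply: eq_bigr => j _; rewrite Egrp.
rewrite big_ord_recr [RHS]big_ord_recr /= subnn E0 Delta1 !mulr1.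
have -> : \sum_(j < k.+1) (j%:R *: Delta (P j)) * Delta (E (k.+1 - j)%N)
    = \sum_(j < k.+1) (j%:R *: (tensor (P j) 1 + tensor 1 (P j)))
        * Delta (E (k.+1 - j)%N).
  apply: eq_bigr => -[[|j] jk] _ /=; first by rewrite !scale0r.
  by rewrite IH // (leq_trans jk).
by move/addrI.
Qed.

Lemma newton_homogeneous_log (charK : [pchar K] =i pred0) (P E : nat -> H) :
  newton P E -> E 0%N = 1 -> (forall d, homogeneous d (E d)) ->
  forall k, (0 < k)%N -> homogeneous k (P k).
Proof.
move=> PE E0 Eh k; have [n] := ubnP k; elim: n k => // n IH [//|k] kn _.
apply: (homogeneousZ_inv (c := k.+1%:R)); first by rewrite (pcharf0P K).1.
have -> : k.+1%:R *: P k.+1 = k.+1%:R *: E k.+1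
    - \sum_(j < k.+1) (j%:R *: P j) * E (k.+1 - j)%N.
  by rewrite PE big_ord_recr /= subnn E0 mulr1 [X in _ = X - _]addrC addrK.
apply: homogeneousB; first exact: homogeneousZ.
apply: homogeneous_sum => -[[|j] jk] _ /=.
  by rewrite scale0r mul0r; apply: homogeneous0.
rewrite -[X in homogeneous X](subnKC (ltnW jk)).
apply: homogeneousM (Eh _); apply/homogeneousZ/IH => //.
exact: leq_trans jk kn.
Qed.

Lemma newton_homogeneous_exp (charK : [pchar K] =i pred0) (P E : nat -> H) :
  newton P E -> E 0%N = 1 -> (forall k, (0 < k)%N -> homogeneous k (P k)) ->
  forall d, homogeneous d (E d).
Proof.
move=> PE E0 Ph d; have [n] := ubnP d; elim: n d => // n IH [_|d dn].
  by rewrite E0; apply: homogeneous1.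
apply: (homogeneousZ_inv (c := d.+1%:R)); first by rewrite (pcharf0P K).1.
rewrite PE; apply: homogeneous_sum => -[[|j] jd] _ /=.
  by rewrite scale0r mul0r; apply: homogeneous0.
rewrite -[X in homogeneous X](subnKC (jd : (j < d.+1)%N)) subSS.
apply: homogeneousM; first exact/homogeneousZ/Ph.
by apply: IH; apply: leq_ltn_trans (leq_subr _ _) _; rewrite -ltnS.
Qed.

End Newton.

(** * Polynomials in a sequence and their linear parts *)

Section Evaluation.
Context (K : fieldType).
Local Notation H := (smalg K forest).
Local Notation F := (smalg K {cmonom nat}).
Local Notation F2 := (smalg K ({cmonom nat} * {cmonom nat})%type).
Implicit Types (s : nat -> H).

Definition evaluate s (Q : F) : H := lextend (monomial s) Q.
HB.instance Definition _ s := GRing.isLinear.Build K F H *:%R (evaluate s)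
  (@lextend_is_linear _ _ _ _).

Lemma evaluateM s P Q : evaluate s (P * Q) = evaluate s P * evaluate s Q.
Proof. exact: lextendM (prodmM _) _ _. Qed.

Lemma evaluate_var s i : evaluate s (mon K (ucm i)) = s i.+1.
Proof. by rewrite /evaluate lextend_mon /monomial prodmU. Qed.

Lemma evaluate1 s : evaluate s 1 = 1.
Proof. by rewrite -mon1 /evaluate lextend_mon /monomial prodm1. Qed.

Lemma coef_tree_evaluate s T Q : tree_sequence s ->
  coef (ucm T) (evaluate s Q)
    = coef (ucm (tree_size T).-1) Q * coef (ucm T) (s (tree_size T)).
Proof.
move=> st; rewrite /evaluate lextendE fcoef_sum -sum_support_delta.
by apply: eq_bigr => m _; rewrite fcoefZ coef_tree_monomial.
Qed.

Definition evaluate2 s (P : F2) : smalg K (forest * forest)%type :=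
  lextend (fun p => tensor (monomial s p.1) (monomial s p.2)) P.
HB.instance Definition _ s := GRing.isLinear.Build K F2
  (smalg K (forest * forest)%type) *:%R (evaluate2 s) (@lextend_is_linear _ _ _ _).

Lemma evaluate2_tensor s P Q :
  evaluate2 s (tensor P Q) = tensor (evaluate s P) (evaluate s Q).
Proof.
elim/smalg_ind: P => [|c m P IH]; first by rewrite tensor0l !linear0 tensor0l.
rewrite tensorPl !linearP /= IH tensorPl; apply: congr_add; last by [].
apply: (congr1 (fun z => _ *: z)) => {IH}.
elim/smalg_ind: Q => [|d n Q IH]; first by rewrite tensor0r !linear0.
rewrite tensorPr !linearP /= IH; apply: congr_add; last by [].
apply: (congr1 (fun z => _ *: z)).
by rewrite tensor_mon /evaluate2 /evaluate !lextend_mon.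
Qed.

(* [x] is a polynomial in the [s n] without constant term, and the coefficient
   of [s d] in this polynomial is [c]. *)
Definition linear_part s (d : nat) (c : K) (x : H) : Prop :=
  exists Q, [/\ evaluate s Q = x, coef mone Q = 0 & coef (ucm d.-1) Q = c].

Lemma linear_part0 s d : linear_part s d 0 0.
Proof. by exists 0; rewrite linear0 !fcoef0. Qed.

Lemma linear_partP s d k c c' x y : linear_part s d c x -> linear_part s d c' y ->
  linear_part s d (k * c + c') (k *: x + y).
Proof.
move=> [P [<- P0 <-]] [Q [<- Q0 <-]]; exists (k *: P + Q).
by rewrite linearP !fcoefPl P0 Q0 mulr0 addr0.
Qed.

Lemma linear_partZ s d k c x :
  linear_part s d c x -> linear_part s d (k * c) (k *: x).
Proof.
by move=> xc; rewrite -[_ * _]addr0 -[_ *: _]addr0; apply/linear_partP/linear_part0.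
Qed.

Lemma linear_partZ_inv s d k c x : k != 0 ->
  linear_part s d (k * c) (k *: x) -> linear_part s d c x.
Proof.
by move=> k0 /(linear_partZ k^-1); rewrite scalerA mulVf // scale1r mulKf.
Qed.

Lemma linear_partD s d c c' x y : linear_part s d c x -> linear_part s d c' y ->
  linear_part s d (c + c') (x + y).
Proof. by rewrite -{2}[c]mul1r -{2}[x]scale1r; apply: linear_partP. Qed.

Lemma linear_partB s d c c' x y : linear_part s d c x -> linear_part s d c' y ->
  linear_part s d (c - c') (x - y).
Proof.
by move=> xc yc; rewrite -mulN1r -scaleN1r; apply/linear_partD/linear_partZ.
Qed.

Lemma linear_part_sum0 s d (I : Type) (r : seq I) (A : pred I) (G : I -> H) :
  (forall i, A i -> linear_part s d 0 (G i)) ->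
  linear_part s d 0 (\sum_(i <- r | A i) G i).
Proof.
move=> G0; apply: big_ind => // [|x y x0 y0]; first exact: linear_part0.
by rewrite -[0]addr0; apply: linear_partD.
Qed.

Lemma linear_partM s d d1 d2 c1 c2 x y :
  linear_part s d1 c1 x -> linear_part s d2 c2 y -> linear_part s d 0 (x * y).
Proof.
move=> [P [<- P0 _]] [Q [<- Q0 _]]; exists (P * Q); rewrite evaluateM.
split=> //; apply/eqP/negPn/negP => /coefM_neq0[k [l [Pk Ql /(congr1 mdeg)]]].
- rewrite mdegM mdeg1 => /esym/eqP; rewrite addn_eq0 mdeg_eq0 => /andP[/eqP k1 _].
  by rewrite k1 P0 eqxx in Pk.
rewrite mdegM mdegU; case: (posnP (mdeg k)) => [/mdeg_eq0I k1|].
  by rewrite k1 P0 eqxx in Pk.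
case: (posnP (mdeg l)) => [/mdeg_eq0I l1|]; first by rewrite l1 Q0 eqxx in Ql.
by case: (mdeg k) => [|i]; case: (mdeg l) => [|j] //; rewrite addnS.
Qed.

Lemma linear_part_var s n : (0 < n)%N -> linear_part s n 1 (s n).
Proof.
case: n => // n _; exists (mon K (ucm n)).
by rewrite evaluate_var !coef_mon cm1_eq1 eqxx.
Qed.

(** In Newton's identity of degree [d], every term but [d P_d] is zero or a product of elements
    without constant term, so [E d] and [P d] have the same linear part. *)
Lemma newton_linear_part (charK : [pchar K] =i pred0) (P E : nat -> H) s a :
  newton P E -> E 0%N = 1 ->
  (forall k, (0 < k)%N -> linear_part s k (a k) (P k)) ->
  forall d, (0 < d)%N -> linear_part s d (a d) (E d).
Proof.
move=> PE E0 Pa d; have [n] := ubnP d; elim: n d => // n IH [//|d] dn _.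
apply: (linear_partZ_inv (k := d.+1%:R)); first by rewrite (pcharf0P K).1.
rewrite PE big_ord_recr /= subnn E0 mulr1 -[_ * a _]add0r; apply: linear_partD.
  apply: linear_part_sum0 => -[[|j] jd] _ /=.
    by rewrite scale0r mul0r; apply: linear_part0.
  apply: (linear_partM _ (linear_partZ _ (Pa _ _)) (IH _ _ _)) => //.
    by rewrite subSS (leq_ltn_trans (leq_subr _ _)).
  by rewrite subn_gt0.
by apply/linear_partZ/Pa.
Qed.

End Evaluation.

(** * The array of a sequence obtained by grafting a grouplike series *)

Section Construction.
Context (K : fieldType) (charK : [pchar K] =i pred0).
Local Notation H := (smalg K forest).
Variables (s P E : nat -> H) (a : nat -> K).
Hypothesis sE : forall k, s k.+1 = grafting (E k).
Hypothesis E0 : E 0%N = 1.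
Hypothesis PE : newton P E.
Hypothesis Pprim : forall k, (0 < k)%N -> Delta (P k) = tensor (P k) 1 + tensor 1 (P k).
Hypothesis Phom : forall k, (0 < k)%N -> homogeneous k (P k).
Hypothesis Plin : forall k, (0 < k)%N -> linear_part s k (a k) (P k).
Hypothesis a1 : a 1%N != 0.

Lemma newton_seq_homogeneous d : homogeneous d (E d).
Proof. exact: newton_homogeneous_exp PE E0 Phom d. Qed.

Lemma newton_seq_tree : tree_sequence s.
Proof.
move=> [//|n] f _; rewrite sE => /(coef_lextend_neq0 (phi := fun f => ucm (graft f))).
case=> h /newton_seq_homogeneous hn <-; exists (graft h) => //.
by rewrite tree_size_graft hn.
Qed.

Lemma Delta_newton_seq m : Delta (s m.+1) =
  tensor (s m.+1) 1 + \sum_(i < m.+1) tensor (E i) (s (m - i).+1).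
Proof.
rewrite sE Delta_grafting (newton_comultiplicative charK PE E0 Pprim).
apply: congr_add; first by [].
rewrite linear_sum; apply: eq_bigr => i _.
by rewrite [LHS]graft_right_tensor sE.
Qed.

Lemma newton_seq_dot : coef (ucm dot) (E 1%N) = a 1%N.
Proof.
have [Q [<- _ <-]] := newton_linear_part charK PE E0 Plin (ltn0Sn 0).
rewrite (coef_tree_evaluate _ _ newton_seq_tree) /dot tree_size_graft forest_size1.
by rewrite sE E0 -mon1 grafting_mon coef_mon eqxx mulr1.
Qed.

(** In [Delta (E d.+1)] only the term [E 1 (x) E d] has a left factor of degree one; it is nonzero
    by induction and because [a 1] is the coefficient of the one-vertex tree in [E 1]. *)
Lemma newton_seq_neq0 d : E d != 0.
Proof.
elim: d => [|d IH]; first by rewrite E0 oner_eq0.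
apply/eqP => Ed0; have /eqP := newton_comultiplicative charK PE E0 Pprim d.+1.
rewrite Ed0 linear0 eq_sym; apply/negP.
have [/hasP[g]|/hasPn noE] := boolP (has predT (support (E d))); last first.
  case/eqP: IH; apply: fcoefP => f; rewrite fcoef0; apply/eqP/negPn/negP.
  by rewrite -supportP => /noE.
rewrite supportP => gE _; apply/eqP => /(congr1 (coef (ucm dot, g))).
rewrite fcoef0 fcoef_sum (bigD1 (Ordinal (isT : 1 < d.+2)%N)) //= big1.
  rewrite addr0 subn1 coef_tensor newton_seq_dot => /eqP.
  by rewrite mulf_eq0 (negbTE a1) (negbTE gE).
move=> i i1; rewrite coef_tensor; apply/eqP; rewrite mulf_eq0; apply/orP; left.
apply/negPn/negP => /newton_seq_homogeneous.
rewrite forest_sizeU /dot tree_size_graft forest_size1 => i1'.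
by case/eqP: i1; apply: val_inj; rewrite /= -i1'.
Qed.

(** In [Delta_newton_seq] the right factor [s i] occurs only beside [E j], whose linear part is
    [a j]. *)
Lemma newton_seq_Lambda i j : (0 < i)%N -> (0 < j)%N ->
  exists Q, Delta (s (i + j)%N) = evaluate2 s Q
    /\ coef (ucm j.-1, ucm i.-1) Q = a j.
Proof.
case: i => // i _; case: j => // j _; set m := (i + j.+1)%N.
have [Q QE] : exists Q : 'I_m.+1 -> smalg K {cmonom nat}, forall l : 'I_m.+1,
    evaluate s (Q l) = E l /\ ((0 < l)%N -> coef (ucm l.-1) (Q l) = a l).
  apply: (fin_all_exists (P := fun (l : 'I_m.+1) Q => evaluate s Q = E l
    /\ ((0 < l)%N -> coef (ucm l.-1) Q = a l))) => -[[|l] lm] /=.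
    by exists 1; rewrite evaluate1 E0.
  have [Q [QE _ Qa]] := newton_linear_part charK PE E0 Plin (ltn0Sn l).
  by exists Q.
(* The variable of index [m - l] stands for [s (m - l).+1]. *)
exists (tensor (mon K (ucm m)) 1 + \sum_(l < m.+1) tensor (Q l) (mon K (ucm (m - l)%N))).
split.
  rewrite addSn Delta_newton_seq linearD /= [X in _ = X + _]evaluate2_tensor.
  rewrite evaluate_var evaluate1; apply: congr_add; first by [].
  rewrite linear_sum; apply: eq_bigr => l _.
  by rewrite [RHS]evaluate2_tensor evaluate_var (QE l).1.
rewrite fcoefD coef_tensor -mon1 !coef_mon (eq_sym mone) cm1_eq1 mulr0 add0r.
have jm : (j.+1 < m.+1)%N by rewrite ltnS leq_addl.
rewrite fcoef_sum (bigD1 (Ordinal jm)) //= big1 => [|l lj].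
  rewrite addr0 coef_tensor coef_mon (QE (Ordinal jm)).2 // addnK eqxx mulr1.
  by [].
rewrite coef_tensor coef_mon; case: eqP => [/ucm_inj ml|]; last by rewrite mulr0.
case/eqP: lj; apply: val_inj => /=; apply/eqP.
rewrite -(eqn_add2l i) -/m -ml subnK //.
by rewrite -ltnS.
Qed.

End Construction.

(** * Hopf subalgebras *)

Section HopfSubalgebra.
Context (K : fieldType).
Local Notation H := (smalg K forest).
Local Notation H2 := (smalg K (forest * forest)%type).
Implicit Types (A : H -> Prop) (s : nat -> H).

Definition subalgebra A : Prop :=
  [/\ A 1, forall (c : K) x y, A x -> A y -> A (c *: x + y)
    & forall x y, A x -> A y -> A (x * y)].

Section Closure.
Variables (A : H -> Prop) (Asub : subalgebra A).

Lemma subalgebra1 : A 1. Proof. by case: Asub. Qed.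

Lemma subalgebraM x y : A x -> A y -> A (x * y).
Proof. by case: Asub => _ _; apply. Qed.

Lemma subalgebra0 : A 0.
Proof.
by case: Asub => A1 AP _; rewrite -(addNr 1) -scaleN1r; apply: AP.
Qed.

Lemma subalgebraD x y : A x -> A y -> A (x + y).
Proof. by case: Asub => _ AP _; rewrite -{2}[x]scale1r; apply: AP. Qed.

Lemma subalgebraZ c x : A x -> A (c *: x).
Proof.
by case: Asub => _ AP _ Ax; rewrite -[_ *: _]addr0; apply/AP/subalgebra0.
Qed.

Lemma subalgebraB x y : A x -> A y -> A (x - y).
Proof.
by move=> Ax Ay; rewrite -scaleN1r; apply/subalgebraD/subalgebraZ.
Qed.

Lemma subalgebra_sum (I : Type) (r : seq I) (Q : pred I) (G : I -> H) :
  (forall i, Q i -> A (G i)) -> A (\sum_(i <- r | Q i) G i).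
Proof. by move=> AG; apply: big_ind => //; [apply: subalgebra0|apply: subalgebraD]. Qed.

End Closure.

Definition subalgebra_of s (x : H) : Prop :=
  forall A, subalgebra A -> (forall n, (0 < n)%N -> A (s n)) -> A x.

Lemma subalgebra_of_closed s : subalgebra (subalgebra_of s).
Proof.
split=> [A|c x y sx sy A|x y sx sy A] Asub As; first exact: subalgebra1.
  by case: (Asub) => _ AP _; apply: AP; [apply: sx|apply: sy].
by apply: subalgebraM; [|apply: sx|apply: sy].
Qed.

Lemma subalgebra_of_gen s n : (0 < n)%N -> subalgebra_of s (s n).
Proof. by move=> n0 A _; apply. Qed.

Lemma subalgebra_of_generated (t : nat -> HCK K) x :
  generated t x <-> subalgebra_of (fun n => seal (t n)) (seal x).
Proof.
split=> [tx A [A1 AP AM] At|sx A [A1 AP AM] At].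
  apply: (tx (fun x => A (seal x))) => //; split=> [|c y z Ay Az|y z Ay Az].
  - by rewrite rmorph1.
  - by rewrite linearP; apply: AP.
  - by rewrite rmorphM; apply: AM.
rewrite -[x]sealK; apply: (sx (fun y => A (unseal y))) => [|n n0]; last first.
  by rewrite sealK; apply: At.
split=> [|c y z Ay Az|y z Ay Az].
- by rewrite -(rmorph1 (@seal K _)) sealK.
- by rewrite linearP; apply: AP.
- by rewrite -[y]unsealK -[z]unsealK -rmorphM sealK; apply: AM.
Qed.

Lemma subalgebra_of_evaluate s Q : subalgebra_of s (evaluate s Q).
Proof.
have sA := subalgebra_of_closed s.
elim/smalg_ind: Q => [|c m Q IH]; first by rewrite linear0; apply: subalgebra0.
rewrite linearP; case: (sA) => _ AP _; apply: AP => //=.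
elim/cmonom_ind: m => [|i m IHm]; first by rewrite mon1 evaluate1; apply: subalgebra1.
rewrite monM evaluateM evaluate_var; apply: (subalgebraM sA) => //.
exact: subalgebra_of_gen.
Qed.

Definition tensor_square A (z : H2) : Prop :=
  exists2 r : seq (H * H), (forall p, p \in r -> A p.1 /\ A p.2)
    & z = \sum_(p <- r) tensor p.1 p.2.

Section TensorSquare.
Variables (A : H -> Prop) (Asub : subalgebra A).

Lemma tensor_squareT x y : A x -> A y -> tensor_square A (tensor x y).
Proof.
move=> Ax Ay; exists [:: (x, y)]; last by rewrite big_seq1.
by move=> p; rewrite inE => /eqP ->.
Qed.

Lemma tensor_square0 : tensor_square A 0.
Proof. by exists [::]; rewrite // big_nil. Qed.

Lemma tensor_squareD z w : tensor_square A z -> tensor_square A w ->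
  tensor_square A (z + w).
Proof.
move=> [r rA ->] [r' rA' ->]; exists (r ++ r'); last by rewrite big_cat.
by move=> p; rewrite mem_cat => /orP[/rA|/rA'].
Qed.

Lemma tensor_square_sum (I : eqType) (r : seq I) (G : I -> H2) :
  (forall i, i \in r -> tensor_square A (G i)) ->
  tensor_square A (\sum_(i <- r) G i).
Proof.
move=> AG; rewrite big_seq; apply: big_ind => //.
  exact: tensor_square0.
exact: tensor_squareD.
Qed.

Lemma tensor_squareZ c z : tensor_square A z -> tensor_square A (c *: z).
Proof.
move=> [r rA ->]; rewrite scaler_sumr; apply: tensor_square_sum => p /rA[Ax Ay].
by rewrite -tensorZl; apply: tensor_squareT => //; apply: subalgebraZ.
Qed.

Lemma tensor_squareM z w : tensor_square A z -> tensor_square A w ->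
  tensor_square A (z * w).
Proof.
move=> [r rA ->] [r' rA' ->]; rewrite mulr_suml.
apply: tensor_square_sum => p /rA[Ax Ay]; rewrite mulr_sumr.
apply: tensor_square_sum => q /rA'[Ax' Ay']; rewrite tensorM.
by apply: tensor_squareT; apply: subalgebraM.
Qed.

End TensorSquare.

(** The elements whose coproduct lies in the tensor square form a subalgebra, so generators
    suffice. *)
Lemma Delta_subalgebra_of s :
  (forall n, (0 < n)%N -> tensor_square (subalgebra_of s) (Delta (s n))) ->
  forall x, subalgebra_of s x -> tensor_square (subalgebra_of s) (Delta x).
Proof.
have sA := subalgebra_of_closed s.
move=> sD x sx; apply: (sx (fun y => tensor_square _ (Delta y))) => //.
split=> [|c y z yD zD|y z yD zD].
- by rewrite Delta1 -tensor11; apply: tensor_squareT; apply: subalgebra1.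
- by rewrite linearP; apply: tensor_squareD => //; apply: tensor_squareZ.
- by rewrite DeltaM; apply: tensor_squareM.
Qed.

(* The homogeneous components of [x], collected in a polynomial. *)
Lemma subalgebra_of_components s :
  (forall n, (0 < n)%N -> homogeneous n (s n)) -> forall x, subalgebra_of s x ->
  exists2 p : {poly H}, x = p.[1]
    & forall i, subalgebra_of s p`_i /\ homogeneous i p`_i.
Proof.
have sA := subalgebra_of_closed s.
move=> sh x sx; apply: (sx (fun x => exists2 p : {poly H}, x = p.[1]
  & forall i, subalgebra_of s p`_i /\ homogeneous i p`_i)); last first.
  move=> n n0; exists ((s n)%:P * 'X^n) => [|i]; first by rewrite hornerM hornerC hornerXn expr1n mulr1.
  rewrite coefCM coefXn; case: eqP => [->|_]; rewrite ?mulr1 ?mulr0.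
    by split; [apply: subalgebra_of_gen|apply: sh].
  by split; [apply: subalgebra0|apply: homogeneous0].
split=> [|c _ _ [p -> pP] [q -> qP]|_ _ [p -> pP] [q -> qP]].
- exists 1 => [|i]; first by rewrite hornerC.
  rewrite coef1; case: i => [|i] /=.
    by split; [apply: subalgebra1|apply: homogeneous1].
  by split; [apply: subalgebra0|apply: homogeneous0].
- exists ((c *: 1) *: p + q) => [|i]; first by rewrite hornerD hornerZ -scalerAl mul1r.
  rewrite coefD coefZ -scalerAl mul1r; case: (pP i) (qP i) => [ps ph] [qs qh].
  split; first by apply: (subalgebraD sA) => //; apply: (subalgebraZ sA).
  by apply: homogeneousD => //; apply: homogeneousZ.
exists (p * q) => [|i]; first by rewrite hornerM.
rewrite coefM; split.
  by apply: (subalgebra_sum sA) => j _; apply: (subalgebraM sA); [case: (pP j)|case: (qP (i - j)%N)].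
apply: homogeneous_sum => j _; have ji : (j <= i)%N by rewrite -ltnS.
rewrite -[X in homogeneous X](subnKC ji).
by apply: homogeneousM; [case: (pP j)|case: (qP (i - j)%N)].
Qed.

Definition restrict (M : conomType) (q : pred M) (x : smalg K M) : smalg K M :=
  lextend (fun k => if q k then mon K k else 0) x.
HB.instance Definition _ (M : conomType) (q : pred M) :=
  GRing.isLinear.Build K (smalg K M) (smalg K M) *:%R (restrict q)
    (@lextend_is_linear _ _ _ _).

Lemma coef_restrict (M : conomType) (q : pred M) x k :
  coef k (restrict q x) = if q k then coef k x else 0.
Proof.
elim/smalg_ind: x => [|c l x IH]; first by rewrite linear0 !fcoef0 if_same.
rewrite linearP !fcoefPl /= IH /restrict lextend_mon.
have [->|lk] := eqVneq l k.
  by case: ifP => _; rewrite ?fcoef0 ?mulr0 ?addr0.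
case: (q l); case: (q k); rewrite ?fcoef0 ?coef_mon ?(negbTE lk) ?mulr0 ?add0r //.
Qed.

Lemma restrict_tensor (q r : pred forest) (x y : H) :
  restrict (fun p => q p.1 && r p.2) (tensor x y)
    = tensor (restrict q x) (restrict r y).
Proof.
apply: fcoefP => -[f g]; rewrite coef_restrict !coef_tensor !coef_restrict /=.
by case: (q f); case: (r g); rewrite ?mul0r ?mulr0.
Qed.

(** A right factor other than 1 has positive degree, which leaves degree less than [d] for the left
    one. *)
Lemma Delta_split d (x : H) : (forall f, coef f x != 0 -> (forest_size f < d.+1)%N) ->
  Delta x = tensor x 1
    + restrict (fun p => (forest_size p.1 < d)%N && (p.2 != mone)) (Delta x).
Proof.
move=> xd; apply: fcoefP => -[f g]; rewrite fcoefD coef_tensor -mon1 coef_mon.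
rewrite coef_restrict /= eq_sym; have [->|g1] := eqVneq g mone.
  by rewrite andbF addr0 mulr1 coef_Delta_oner.
rewrite andbT mulr0 add0r; case: ifP => // /negbT fd.
apply/eqP/negPn/negP => /Delta_degree[h /xd hd fgh]; case/negP: fd.
rewrite -ltnS; apply: leq_trans hd; rewrite ltnS -fgh -addn1 leq_add2l.
by rewrite lt0n forest_size_eq0.
Qed.

(* By [Delta_split], the antipode equation expresses [S x] through the values of
   [S] in smaller degrees. *)
Lemma antipode_subalgebra_of s (S : {linear H -> H}) :
  (forall n, (0 < n)%N -> homogeneous n (s n)) ->
  (forall n, (0 < n)%N -> tensor_square (subalgebra_of s) (Delta (s n))) ->
  (forall x, lextend (fun p => S (mon K p.1) * mon K p.2) (Delta x)
    = coef mone x *: 1) ->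
  forall x, subalgebra_of s x -> subalgebra_of s (S x).
Proof.
have sA := subalgebra_of_closed s.
move=> sh sD SD.
have Stensor u v : lextend (fun p => S (mon K p.1) * mon K p.2) (tensor u v) = S u * v.
  elim/smalg_ind: u => [|c f u IH]; first by rewrite tensor0l !linear0 mul0r.
  rewrite tensorPl !linearP /= IH mulPl; congr (_ *: _ + _) => {IH}.
  elim/smalg_ind: v => [|d g v IH]; first by rewrite tensor0r linear0 mulr0.
  rewrite tensorPr linearP /= IH mulPr; congr (_ *: _ + _).
  by rewrite tensor_mon lextend_mon.
suff main d x : subalgebra_of s x ->
    (forall f, coef f x != 0 -> (forest_size f < d)%N) -> subalgebra_of s (S x).
  move=> x /(subalgebra_of_components sh)[p -> pP].
  rewrite horner_coef linear_sum; apply: (subalgebra_sum sA) => i _.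
  rewrite expr1n mulr1; case: (pP i) => pi ph.
  by apply: (main i.+1) => // f /ph ->.
elim: d x => [|d IH] x sx xd.
  have -> : x = 0 by apply: fcoefP => f; rewrite fcoef0; apply/eqP/negPn/negP => /xd.
  by rewrite linear0; apply: subalgebra0.
have [r rA rE] := Delta_subalgebra_of sD sx.
have := SD x; rewrite {1}(Delta_split xd) linearD /= Stensor mulr1 => /(canRL (addrK _)) ->.
apply: (subalgebraB sA); first apply: (subalgebraZ sA) (subalgebra1 sA).
rewrite rE !linear_sum big_seq; apply: (subalgebra_sum sA) => -[u v] /rA /= [su sv].
rewrite (restrict_tensor (fun f => forest_size f < d)%N (fun g => g != mone)) Stensor.
apply: (subalgebraM sA).
  apply: IH => [|f]; last by rewrite coef_restrict; case: ifP => //; rewrite eqxx.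
  (* The truncation of [u] below degree [d] is a sum of homogeneous components of [u], hence still
     in the subalgebra. *)
  have [p -> pP] := subalgebra_of_components sh su.
  rewrite horner_coef linear_sum; apply: (subalgebra_sum sA) => i _ /=.
  rewrite expr1n mulr1; case: (pP i) => pi ph.
  have -> : restrict (fun f => forest_size f < d)%N p`_i = if (i < d)%N then p`_i else 0.
    apply: fcoefP => f; rewrite coef_restrict; have [e|/ph ->] := eqVneq (coef f p`_i) 0.
      by rewrite e if_same; case: ifP => _; rewrite ?fcoef0 ?e.
    by case: ifP => _; rewrite ?fcoef0.
  by case: ifP => _ //; apply: subalgebra0.
have -> : restrict (fun g => g != mone) v = v - coef mone v *: 1.
  apply: fcoefP => g; rewrite coef_restrict fcoefB fcoefZ -mon1 coef_mon eq_sym.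
  by have [<-|_] := eqVneq mone g; rewrite ?mulr1 ?subrr ?mulr0 ?subr0.
apply: (subalgebraB sA) => //; apply: (subalgebraZ sA) (subalgebra1 sA).
Qed.

End HopfSubalgebra.

(** * Logarithm and exponential *)

Section LogExp.
Context (K : fieldType) (charK : [pchar K] =i pred0) (A : comAlgType K).
Implicit Types (p q v : {poly A}) (e : nat -> A).

Lemma coef_exp_prefix n p q : (forall i, (i <= n)%N -> p`_i = q`_i) ->
  forall k i, (i <= n)%N -> (p ^+ k)`_i = (q ^+ k)`_i.
Proof.
move=> pq; elim=> [|k IH] i i_n //; rewrite !exprS !coefM.
apply: eq_bigr => j _; rewrite pq ?IH // (leq_trans _ i_n) ?leq_subr //.
by rewrite -ltnS.
Qed.

Lemma coef_exp_low p : p`_0 = 0 -> forall k n, (n < k)%N -> (p ^+ k)`_n = 0.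
Proof.
move=> p0; elim=> [|k IH] n // nk; rewrite exprS coefM big1 // => -[[|j] jn] _ /=.
  by rewrite p0 mul0r.
rewrite IH ?mulr0 // (leq_trans _ (nk : (n <= k)%N)) // ltn_subrL.
exact: leq_ltn_trans (leq0n j) (jn : (j < n)%N).
Qed.

Lemma sign_scale k p : (-1) ^+ k *: p = (-1) ^+ k * p.
Proof.
elim: k => [|k IH]; first by rewrite scale1r mul1r.
by rewrite !exprS !mulN1r scaleNr mulNr IH.
Qed.

(** For [e 0 = 1] this is the series [e - 1], truncated below degree [N]. *)
Definition positive_part e N : {poly A} :=
  \poly_(i < N) (if i == 0%N then 0 else e i).

(** The coefficient of degree [n] of [log(1 + w)] with [w = e - 1]: as [w ^+ k] starts in degree
    [k], the powers [k <= n] suffice. *)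
Definition log_coef e n : A :=
  \sum_(1 <= k < n.+1) ((-1) ^+ k.+1 / k%:R) *: (positive_part e n.+1 ^+ k)`_n.

Lemma newton_succ (P E : nat -> A) :
  (forall d, d.+1%:R *: E d.+1
     = \sum_(j < d.+1) (j.+1%:R *: P j.+1) * E (d - j)%N) -> newton P E.
Proof.
move=> PE [|d]; rewrite big_ord_recl /= !scale0r mul0r add0r; last exact: PE.
by rewrite big_ord0.
Qed.

(** The truncated logarithm [Lg] satisfies [Lg' (1 + w) = w'] up to degree [d]; the coefficient of
    degree [d] of this equality is Newton's identity of degree [d + 1]. *)
Lemma newton_log e : e 0%N = 1 -> newton (log_coef e) e.
Proof.
move=> e0; apply: newton_succ => d; set w := positive_part e d.+2.
have w0 : w`_0 = 0 by rewrite coef_poly.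
pose c k : K := (-1) ^+ k / k.+1%:R.
pose Lg := \sum_(k < d.+1) (c k)%:A *: w ^+ k.+1.
have LgE n : (n <= d.+1)%N -> log_coef e n = Lg`_n.
  move=> nd; rewrite /log_coef coef_sum big_add1 /= -(big_mkord xpredT
    (fun k => ((c k)%:A *: w ^+ k.+1)`_n)) (big_cat_nat (leq0n n) nd) /=.
  rewrite [X in _ + X]big_nat_cond [X in _ + X]big1 ?addr0; last first.
    by move=> k /andP[/andP[nk _] _]; rewrite coefZ coef_exp_low ?mulr0.
  apply: eq_bigr => k _; rewrite coefZ mulr_algl.
  have -> : (-1) ^+ k.+2 / k.+1%:R = c k by rewrite /c !exprS !mulN1r opprK.
  congr (_ *: _); apply: (@coef_exp_prefix n) => // i i_n.
  by rewrite !coef_poly !ltnS i_n (leq_trans i_n).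
have Lg' : Lg^`() = w^`() * \sum_(k < d.+1) (- w) ^+ k.
  rewrite /Lg raddf_sum mulr_sumr; apply: eq_bigr => k _ /=.
  rewrite derivZ deriv_exp /= exprNn -sign_scale -scalerAr -scalerMnr scalerMnl.
  have -> : (c k)%:A *+ k.+1 = (-1) ^+ k :> A.
    rewrite scalerMnl -mulr_natr divfK ?(pcharf0P K).1 //.
    exact: (rmorph_sign (in_alg A)).
  by [].
(* The derivative of [Lg] contains a geometric sum, which [1 + w] telescopes; the remainder
   [(- w) ^+ d.+1] starts in degree [d + 1] and is invisible below. *)
have geom : Lg^`() * (1 + w) = w^`() * (1 - (- w) ^+ d.+1).
  rewrite Lg' -mulrA; congr (_ * _); rewrite mulrC.
  by rewrite -[1 + w]opprK opprD -[- 1 - w]addrC mulNr -subrX1 opprB.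
have := congr1 (fun p : {poly A} => p`_d) geom; rewrite /= coefM mulrBr mulr1 coefB.
rewrite [X in _ - X](_ : _ = 0) ?subr0; last first.
  rewrite coefM big1 // => j _; rewrite (@coef_exp_low (- w)) ?mulr0 //.
    by rewrite coefN w0 oppr0.
  by rewrite ltnS leq_subr.
rewrite coef_deriv coef_poly ltnS leqnn /= -scaler_nat => <-.
apply: eq_bigr => j _; have jd : (j <= d)%N by rewrite -ltnS.
rewrite LgE // coef_deriv -scaler_nat; congr (_ * _).
rewrite coefD coef1 coef_poly ltnS (leq_trans (leq_subr _ _)) //.
by case: eqP => [->|_]; rewrite ?addr0 ?add0r ?e0.
Qed.

Definition exp_coef v n : A := \sum_(m < n.+1) (m`!%:R)^-1 *: (v ^+ m)`_n.

(** Differentiating the exponential truncated after the power [d + 1] gives [v'] times the one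
    truncated after the power [d]; as [v ^+ m] starts in degree [m], neither truncation affects the
    coefficients compared. *)
Lemma newton_exp v : v`_0 = 0 -> newton (fun k => v`_k) (exp_coef v).
Proof.
move=> v0; apply: newton_succ => d.
pose Ex N := \sum_(m < N.+1) ((m`!%:R)^-1 : K)%:A *: v ^+ m.
have ExE N n : (n <= N)%N -> exp_coef v n = (Ex N)`_n.
  move=> nN; rewrite /exp_coef coef_sum -(big_mkord xpredT
    (fun m => (m`!%:R)^-1 *: (v ^+ m)`_n)) -(big_mkord xpredT
    (fun m => (((m`!%:R)^-1 : K)%:A *: v ^+ m)`_n)).
  rewrite [RHS](big_cat_nat (leq0n n.+1) (nN : n.+1 <= N.+1)%N) /=.
  rewrite [X in _ = _ + X]big_nat_cond [X in _ = _ + X]big1 ?addr0; last first.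
    by move=> k /andP[/andP[nk _] _]; rewrite coefZ coef_exp_low ?mulr0.
  by apply: eq_bigr => m _; rewrite coefZ mulr_algl.
have Ex' : (Ex d.+1)^`() = v^`() * Ex d.
  rewrite /Ex raddf_sum big_ord_recl /= expr0 alg_polyC derivC add0r.
  rewrite mulr_sumr; apply: eq_bigr => m _ /=.
  rewrite derivZ deriv_exp /= -scalerAr -scalerMnr scalerMnl.
  rewrite [X in X *: _]scalerMnl; congr (_%:A *: _); rewrite -mulr_natr factS natrM invfM mulrAC mulVf ?mul1r //.
  by rewrite (pcharf0P K).1.
rewrite (ExE d.+1) // scaler_nat -coef_deriv Ex' coefM; apply: eq_bigr => j _.
by rewrite coef_deriv scaler_nat (ExE d) // leq_subr.
Qed.

End LogExp.

(** * Classification *)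

Section Candidates.
Context (K : fieldType) (charK : [pchar K] =i pred0).
Local Notation H := (smalg K forest).
Implicit Types (t : nat -> HCK K).

(** Closure under the coproduct holds because every [E i] is a polynomial in the [t_n]; closure
    under the antipode then follows from the grading. *)
Lemma newton_seq_strong t (P E : nat -> H) (a : nat -> K) :
  (forall k, seal (t k.+1) = grafting (E k)) -> E 0%N = 1 -> newton P E ->
  (forall k, (0 < k)%N -> Delta (P k) = tensor (P k) 1 + tensor 1 (P k)) ->
  (forall k, (0 < k)%N -> homogeneous k (P k)) ->
  (forall k, (0 < k)%N -> linear_part (fun n => seal (t n)) k (a k) (P k)) ->
  a 1%N != 0 -> in_Seq t /\ is_Lambda_array t (fun _ => a).
Proof.
move=> tE E0 PE Pprim Phom Plin a1; set s := fun n => seal (t n).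
have st : tree_sequence s := newton_seq_tree charK (s := s) tE E0 PE Phom.
have sh n : (0 < n)%N -> homogeneous n (s n).
  by move=> n0 f /(st n f n0)[T -> <-]; rewrite forest_sizeU.
have sA := subalgebra_of_closed s.
have sD n : (0 < n)%N -> tensor_square (subalgebra_of s) (Delta (s n)).
  case: n => // m _; rewrite (Delta_newton_seq charK (s := s) tE E0 PE Pprim).
  apply: tensor_squareD.
    by apply: tensor_squareT; [apply: subalgebra_of_gen|apply: subalgebra1].
  apply: tensor_square_sum => i _; apply: tensor_squareT; last exact: subalgebra_of_gen.
  case: (nat_of_ord i) => [|j]; first by rewrite E0; apply: subalgebra1.
  have [Q [<- _ _]] := newton_linear_part charK PE E0 Plin (ltn0Sn j).
  exact: subalgebra_of_evaluate.
split; first split.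
- case=> // n _; split; last first.
    move=> f ft; have [|T fT Tn] := st n.+1 f (ltn0Sn n); last by exists T.
    by rewrite coef_seal mcoeff_neq0.
  apply: contraNneq (newton_seq_neq0 charK (s := s) tE E0 PE Pprim Phom Plin a1 n) => t0.
  by apply/eqP/grafting_inj; rewrite -tE t0 !linear0.
- by apply: (can_inj (@sealK K _)); rewrite tE E0 seal_tree rtree_of_leaf -mon1 grafting_mon.
- split=> [|x tx|S Santi x tx].
  + split=> [A [A1 _ _] _ //|c x y tx ty A Asub At|x y tx ty A Asub At].
      by case: (Asub) => _ AP _; apply: AP; [apply: tx|apply: ty].
    by case: (Asub) => _ _ AM; apply: AM; [apply: tx|apply: ty].
  + have [r rA rE] := Delta_subalgebra_of sD ((subalgebra_of_generated t x).1 tx).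
    exists [seq (unseal p.1, unseal p.2) | p <- r]; split.
      move=> _ /mapP[p /rA[p1 p2] ->] /=.
      by split; apply/subalgebra_of_generated; rewrite unsealK.
    apply: (can_inj (@sealK K _)); rewrite seal_coproduct rE big_map linear_sum.
    by apply: eq_bigr => p _ /=; rewrite seal_tens !unsealK.
  + apply/subalgebra_of_generated.
    pose S' : {linear H -> H} := [the {linear _ -> _} of @seal K _ \o S \o @unseal K _].
    have := antipode_subalgebra_of (S := S') sh sD _ ((subalgebra_of_generated t x).1 tx).
    rewrite /S' /= sealK; apply => y.
    have [/(congr1 (@seal K _)) + _] := Santi (unseal y).
    rewrite linearZ rmorph1 /= /counit -fcoefE => <-.
    rewrite -{1}[y]unsealK -seal_coproduct lextend_seal lextE linear_sum.
    apply: eq_bigr => p _; rewrite linearZ /= rmorphM !monE !sealK.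
    by [].
- move=> i j i0 j0.
  have [Q [QD Qa]] := newton_seq_Lambda charK (s := s) tE E0 PE Pprim Plin i0 j0.
  exists (unseal Q); split; last by rewrite -fcoefE.
  apply: (can_inj (@sealK K _)).
  by rewrite seal_coproduct QD seal_seq_tensor unsealK.
Qed.

(** The value 1 in degree 0 makes the series grouplike and gives [B_+] the same effect in every
    degree; [ladder K 0] is the one-vertex tree. *)
Definition ladders (n : nat) : H := if n is 0 then 1 else seal (ladder K n).

Lemma ladder_tree_graft n : ladder_tree n.+2 = graft (ucm (ladder_tree n.+1)).
Proof.
rewrite (_ : ucm _ = forest_of [:: iter n (fun u => PNode [:: u]) (PNode [::])]).
  by rewrite graft_forest_of.
by rewrite /forest_of big_seq1.
Qed.

Lemma laddersS n : ladders n.+1 = mon K (ucm (ladder_tree n.+1)).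
Proof. exact: seal_tree. Qed.

Lemma grafting_ladders n : grafting (ladders n) = ladders n.+1.
Proof.
case: n => [|n]; last by rewrite !laddersS grafting_mon ladder_tree_graft.
have -> : ladders 0 = mon K mone by rewrite mon1.
rewrite laddersS grafting_mon; apply: (congr1 (fun T => mon K (ucm T))).
exact/esym/rtree_of_leaf.
Qed.

(** Grafting the right factors of the sum for [d] gives the terms [i <= d] of the sum for [d + 1],
    and the cocycle property adds the term with right factor 1. *)
Lemma Delta_ladders d :
  Delta (ladders d) = \sum_(i < d.+1) tensor (ladders i) (ladders (d - i)%N).
Proof.
elim: d => [|d IH]; first by rewrite big_ord1 Delta1 tensor11.
rewrite -{1}grafting_ladders Delta_grafting grafting_ladders IH linear_sum.
rewrite [RHS]big_ord_recr /= subnn [LHS]addrC; apply: congr_add; last by [].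
apply: eq_bigr => i _; rewrite graft_right_tensor grafting_ladders subSn //.
by rewrite -ltnS.
Qed.

Lemma homogeneous_ladders d : homogeneous d (ladders d).
Proof.
elim: d => [|d IH]; first exact: homogeneous1.
move=> f; rewrite -grafting_ladders.
case/(coef_lextend_neq0 (phi := fun f => ucm (graft f))) => h /IH hd <-.
by rewrite forest_sizeU tree_size_graft hd.
Qed.

(** Expanding the power chooses one degree in each of its [k] factors; a zero degree contributes
    nothing because the constant term has been removed. *)
Lemma coef_compositions n k :
  \sum_(j : {ffun 'I_k -> 'I_n.+1} |
      [forall a, (0 < j a)%N] && ((\sum_a j a)%N == n)) \prod_a ladders (j a)
  = (positive_part ladders n.+1 ^+ k)`_n.
Proof.
rewrite /positive_part poly_def -[X in _ ^+ X]card_ord -prodr_const.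
rewrite bigA_distr_bigA coef_sum big_mkcond; apply: eq_bigr => j _ /=.
rewrite scaler_prod prodrXr coefZ coefXn.
case: eqP => [->|/eqP jn]; last by rewrite andbF eq_sym (negbTE jn) mulr0.
rewrite eqxx mulr1 andbT; case: ifPn => [/forallP j0|].
  by apply: eq_bigr => a _; rewrite eqn0Ngt j0.
by case/forallPn=> a; rewrite -eqn0Ngt => ja; rewrite (bigD1 a) //= ja mul0r.
Qed.

(** The [p_n] are the coefficients of the logarithm of the ladder series, which is the reason why
    they are primitive. *)
Lemma seal_p n : seal (p_ K n) = log_coef ladders n.
Proof.
rewrite /p_ linear_sum; apply: eq_bigr => k _; rewrite -coef_compositions.
rewrite linear_sum scaler_sumr; apply: eq_bigr => j /andP[/forallP j0 _].
rewrite linearZ /= rmorph_prod; congr (_ *: _); apply: eq_bigr => a _.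
by case: (nat_of_ord (j a)) (j0 a).
Qed.

Local Notation pp := (log_coef ladders).

Lemma newton_ladders : newton pp ladders.
Proof. exact: newton_log. Qed.

Lemma pp_primitive k : (0 < k)%N -> Delta (pp k) = tensor (pp k) 1 + tensor 1 (pp k).
Proof. exact: newton_primitive newton_ladders erefl Delta_ladders k. Qed.

Lemma pp_homogeneous k : (0 < k)%N -> homogeneous k (pp k).
Proof. exact: newton_homogeneous_log newton_ladders erefl homogeneous_ladders k. Qed.

(** Newton's identity for the ladders, rescaled by [c], expresses [k c^k p_k] as [k c s_k] minus
    products, since [c^j l_j = c s_j] up to rank [k]. The products have no linear part. *)
Lemma pp_linear_part (s : nat -> H) (c : K) k : (0 < k)%N ->
  (forall j, (0 < j <= k)%N -> s j = c ^+ j.-1 *: ladders j) ->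
  linear_part s k c (c ^+ k *: pp k).
Proof.
have [n] := ubnP k; elim: n k => // n IH [//|k] kn _ sl.
apply: (linear_partZ_inv (k := k.+1%:R)); first by rewrite (pcharf0P K).1.
have cs j : (0 < j <= k.+1)%N -> c ^+ j *: ladders j = c *: s j.
  by case: j => // j jk; rewrite sl //= scalerA -exprS.
have -> : k.+1%:R *: (c ^+ k.+1 *: pp k.+1) = k.+1%:R *: (c *: s k.+1)
    - \sum_(j < k.+1) (j%:R *: (c ^+ j *: pp j)) * (c *: s (k.+1 - j)%N).
  apply: (canRL (addrK _)); rewrite -cs ?leqnn // (newton_scale c newton_ladders).
  rewrite [RHS]big_ord_recr /= subnn scale1r mulr1 addrC; congr (_ + _).
  by apply: eq_bigr => j _; rewrite cs // subn_gt0 leq_subr ltn_ord.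
have := linear_partZ k.+1%:R (linear_partZ c (linear_part_var s (ltn0Sn k))).
rewrite mulr1 => lin; rewrite -[_ * c]subr0; apply: linear_partB lin _.
apply: linear_part_sum0 => -[[|j] jk] _ /=.
  by rewrite scale0r mul0r; apply: linear_part0.
have jk' : (j < k)%N by [].
apply: (@linear_partM _ s _ j.+1 (k.+1 - j.+1) (j.+1%:R * c) (c * 1)).
  apply/linear_partZ/IH => //; first exact: leq_trans jk kn.
  move=> i /andP[i0 ij]; apply: sl; rewrite i0 (leq_trans ij) //.
  exact: ltnW.
by apply/linear_partZ/linear_part_var; rewrite subn_gt0.
Qed.

(** The condition on [b] says that [E] agrees with the ladder series below any degree [k] with [b k]
    nonzero. This provides the ladders [t_1, ..., t_k] from which [pp_linear_part] builds [p_k]. *)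
Lemma candidate_Lambda t (E : nat -> H) (b : nat -> K) (c : K) :
  (forall k, seal (t k.+1) = c ^+ k *: grafting (E k)) -> E 0%N = 1 ->
  newton (fun k => b k *: pp k) E ->
  (forall k j, b k != 0 -> (0 < j < k)%N -> b j = 1) ->
  c != 0 -> b 1%N != 0 ->
  in_Seq t /\ is_Lambda_array t (fun _ j => c * b j).
Proof.
move=> tE E0 bE b1 c0 b10.
apply: (newton_seq_strong (P := fun k => c ^+ k *: (b k *: pp k))
                          (E := fun k => c ^+ k *: E k)).
- by move=> k; rewrite tE linearZ.
- by rewrite scale1r.
- exact: (newton_scale c bE).
- move=> k k0; rewrite !linearZ /= pp_primitive // !scalerDr.
  by rewrite !tensorZl !scalerA [c ^+ k * _]mulrC.
- by move=> k k0; apply/homogeneousZ/homogeneousZ/pp_homogeneous.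
- move=> k k0; rewrite [c * _]mulrC scalerA [c ^+ k * _]mulrC -scalerA.
  have [-> | bk] := eqVneq (b k) 0.
    by rewrite scale0r mul0r; apply: linear_part0.
  apply/linear_partZ/pp_linear_part => // -[//|j] jk.
  (* The term of rank [j + 1] involves [E] only in degree [j < k], where it equals the ladder
     series. *)
  rewrite tE; congr (_ *: _); rewrite -grafting_ladders; congr grafting.
  apply: (newton_uniq (n := k) charK bE newton_ladders) => // i ik.
  by rewrite (b1 k) ?scale1r.
- by rewrite mulf_neq0.
Qed.

Lemma strong_order_candidate t (a : nat -> K) : a 1%N != 0 ->
  in_Seq t -> is_Lambda_array t (fun _ => a) -> is_strong_order 0 t.
Proof.
move=> a1 tS tL; split=> //; exists (fun _ => a); split=> // [j _|].
  exists (a j)%:P; split; first by rewrite size_polyC; case: eqP.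
  by move=> i _; rewrite hornerC.
by exists (a 1%N)%:P; rewrite size_polyC a1; split=> // i _; rewrite hornerC.
Qed.

Lemma ladder_candidate t (c : K) : c != 0 ->
  (forall k, (0 < k)%N -> t k = c ^+ k.-1 *: ladder K k) ->
  in_Seq t /\ is_Lambda_array t (fun _ _ => c * 1).
Proof.
move=> c0 tk; apply: (candidate_Lambda (E := ladders) (b := fun=> 1)) => //.
- by move=> k; rewrite tk // linearZ grafting_ladders.
- by apply: newton_ext newton_ladders => // k; rewrite scale1r.
- exact: oner_neq0.
Qed.

Definition Z_coef (n : nat) (b : K) (k : nat) : K :=
  if (k < n)%N then 1 else if k == n then b else 0.

Lemma horner_homogeneous (p : {poly H}) d : (forall i, homogeneous i p`_i) ->
  restrict (fun f => forest_size f == d) p.[1] = p`_d.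
Proof.
move=> ph; rewrite horner_coef linear_sum.
have pi i : restrict (fun f => forest_size f == d) p`_i = if i == d then p`_d else 0.
  apply: fcoefP => f; rewrite coef_restrict.
  have [e|/ph ->] := eqVneq (coef f p`_i) 0.
    by rewrite e if_same; case: eqP => [<-|_]; rewrite ?e ?fcoef0.
  by case: eqP => [->|_]; rewrite ?fcoef0.
rewrite (eq_bigr (fun i : 'I_(size p) => if i == d :> nat then p`_d else 0)); last first.
  by move=> i _; rewrite expr1n mulr1 /= pi.
have [dp|dp] := ltnP d (size p).
  rewrite (bigD1 (Ordinal dp)) //= eqxx big1 ?addr0 // => i.
  by rewrite -val_eqE => /negbTE /= ->.
rewrite big1 => [|i _]; first by rewrite nth_default.
by rewrite ifN // neq_ltn (leq_trans (ltn_ord i) dp).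
Qed.

Lemma seal_component d (x : HCK K) :
  seal (component_of_degree d x) = restrict (fun f => forest_size f == d) (seal x).
Proof.
rewrite /restrict lextend_seal lextE /component_of_degree linear_sum big_mkcond.
apply: eq_bigr => f _; case: ifP => _; last by rewrite scaler0.
by rewrite malgUZ linearZ /= monE.
Qed.

Lemma pp0 : pp 0 = 0.
Proof. by rewrite /log_coef big_geq. Qed.

(** The exponent is [v.[1]] for a polynomial [v] whose coefficient of degree [k] is homogeneous of
    degree [k]. Taking the component of degree [d] of a power of the exponent therefore amounts to
    taking a coefficient of the same power of [v]. *)
Lemma seal_Z n b : (0 < n)%N -> exists2 v : {poly H},
  (forall k, v`_k = Z_coef n b k *: pp k) &
  forall d, seal (Z_ n b d.+1) = grafting (exp_coef v d).
Proof.
move=> n0; pose v := \poly_(k < n.+1) (Z_coef n b k *: pp k).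
have vE k : v`_k = Z_coef n b k *: pp k.
  rewrite coef_poly ltnS; case: ltnP => // nk.
  by rewrite /Z_coef ltnNge (ltnW nk) gtn_eqF //= scale0r.
exists v => // d; rewrite /= seal_Bplus; congr grafting.
rewrite /exp_completed linear_sum; apply: eq_bigr => m _.
rewrite linearZ /= seal_component rmorphXn /=; congr (_ *: _).
set x := seal _; have -> : x = v.[1].
  rewrite /x /v horner_poly big_ord_recr /= /Z_coef ltnn eqxx !expr1n !mulr1.
  rewrite linearD linearZ /= seal_p; apply: congr_add; last by [].
  rewrite linear_sum -(big_mkord xpredT (fun k => (if (k < n)%N then 1
    else if k == n then b else 0) *: pp k * 1 ^+ k)) [RHS]big_ltn //= pp0.
  rewrite scaler0 mul0r add0r big_nat [RHS]big_nat; apply: eq_bigr => k /andP[_ kn].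
  by rewrite kn seal_p scale1r expr1n mulr1.
rewrite -horner_exp; apply: horner_homogeneous.
elim: (nat_of_ord m) => [|{}m IH] i.
  rewrite expr0 coef1; case: i => [|i]; [exact: homogeneous1|exact: homogeneous0].
rewrite exprS coefM; apply: homogeneous_sum => j _.
have ji : (j <= i)%N by rewrite -ltnS.
rewrite -[X in homogeneous X](subnKC ji); apply: homogeneousM (IH _).
rewrite vE; case: (nat_of_ord j) => [|k]; last exact/homogeneousZ/pp_homogeneous.
by rewrite pp0 scaler0; apply: homogeneous0.
Qed.

Lemma Z_coef1_neq0 n b : (0 < n)%N -> b != 0 -> Z_coef n b 1 != 0.
Proof.
move=> n0 b0; rewrite /Z_coef; case: (ltngtP 1%N n) => [_|n1|//].
  exact: oner_neq0.
by rewrite ltnNge n0 in n1.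
Qed.

Lemma Z_candidate t (n : nat) (b c : K) : (0 < n)%N -> b != 0 -> c != 0 ->
  (forall k, (0 < k)%N -> t k = c ^+ k.-1 *: Z_ n b k) ->
  in_Seq t /\ is_Lambda_array t (fun _ j => c * Z_coef n b j).
Proof.
move=> n0 b0 c0 tk; have [v vE vZ] := seal_Z b n0.
apply: (candidate_Lambda (E := exp_coef v)) => //.
- by move=> k; rewrite tk // linearZ /= vZ.
- by rewrite /exp_coef big_ord1 invr1 scale1r expr0 coef1.
- by apply: newton_ext (newton_exp charK _) => //; rewrite vE pp0 scaler0.
- move=> k j; rewrite /Z_coef; case: (ltngtP k n) => [kn _|_|-> _].
  + by case/andP=> _ jk; rewrite (ltn_trans jk).
  + by rewrite eqxx.
  + by case/andP=> _ ->.
exact: Z_coef1_neq0.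
Qed.

End Candidates.

Section Classification.
Context (K : fieldType) (charK : [pchar K] =i pred0).
Implicit Types (t : nat -> HCK K) (a : nat -> K).

(** Order at most 0 makes each column of the array constant, so [a] is its first row; order exactly
    0 of the first column makes [a 1] nonzero. *)
Lemma strong_order0_zeroth t : is_strong_order 0 t ->
  exists2 a, a 1%N != 0 & zeroth_order a (fun n => seal (t n)).
Proof.
move=> [tS [lambda [tL l0 [p [p1 lp]]]]].
exists (lambda 1%N).
  by rewrite lp //; case/eqP/size_poly1P: p1 => c c0 ->; rewrite hornerC.
apply: zeroth_order_Lambda tS tL _ => i j i0 j0.
have [q [/size1_polyC -> lq]] := l0 j j0.
by rewrite !lq // !hornerC.
Qed.

Lemma zeroth_order_ext a a' (s : nat -> smalg K forest) :
  (forall j, (0 < j)%N -> a j = a' j) -> zeroth_order a s -> zeroth_order a' s.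
Proof.
by move=> aa [s1 st sD]; split=> // T T'; rewrite sD aa // tree_size_gt0.
Qed.

Lemma strong_order0_eq t t' a : zeroth_order a (fun n => seal (t n)) ->
  in_Seq t' -> is_Lambda_array t' (fun _ => a) ->
  forall k, (0 < k)%N -> t k = t' k.
Proof.
move=> ta tS tL k k0; apply: (can_inj (@sealK K _)).
apply: (zeroth_order_uniq charK ta _ k0 (s' := fun n => seal (t' n))).
by apply: zeroth_order_Lambda tS tL _.
Qed.

(* By the relation [a (1 + j) * (a 1 - a j) = 0], the coefficients [a j] are
   equal to [a 1] up to some rank [n - 1], and vanish after rank [n]. *)
Lemma zeroth_order_coefficients t a : in_Seq t -> a 1%N != 0 ->
  zeroth_order a (fun n => seal (t n)) ->
  (forall j, (0 < j)%N -> a j = a 1%N) \/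
  exists n b, [/\ (0 < n)%N, b != 0
    & forall j, (0 < j)%N -> a j = a 1%N * Z_coef n b j].
Proof.
case=> tn _ _ a1 ta; have t0 n : (0 < n)%N -> seal (t n) != 0.
  move=> /tn[+ _]; apply: contra => /eqP tn0; apply/eqP.
  by apply: (can_inj (@sealK K _)); rewrite tn0 linear0.
have [ex|all] := classic (exists n, (0 < n)%N && (a n != a 1%N)); last first.
  left=> j j0; apply/eqP/negPn/negP => aj; case: all.
  by exists j; rewrite j0.
right; case: (ex_minnP ex) => n /andP[n0 an] nmin.
have a_lt j : (0 < j < n)%N -> a j = a 1%N.
  case/andP=> j0 jn; apply/eqP/negPn/negP => aj.
  by have := nmin j; rewrite j0 aj leqNgt jn => /(_ isT).
(* For [j >= n] the value [a j] differs from [a 1], either because [j = n] or because it is already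
   zero; the relation then kills [a j.+1]. *)
have a_gt j : (n < j)%N -> a j = 0.
  elim: j => // j IH; rewrite ltnS leq_eqVlt => nj.
  have j0 : (0 < j)%N by case/orP: nj => [/eqP <-//|]; apply: leq_ltn_trans.
  have aj : a 1%N - a j != 0.
    rewrite subr_eq0 eq_sym; case/orP: nj => [/eqP <-//|/IH ->].
    by rewrite eq_sym.
  have /eqP := zeroth_order_relation ta t0 (ltn0Sn 0) j0.
  by rewrite mulf_eq0 (negbTE aj) orbF => /eqP.
have n1 : (1 < n)%N by case: n n0 an {nmin a_lt a_gt} => [//|[|//]]; rewrite eqxx.
have [an0|an0] := eqVneq (a n) 0.
  (* Since [b] must be nonzero, a vanishing [a n] means that the last nonzero value, equal to [a 1],
     is at rank [n - 1]. *)
  exists n.-1, 1; split; [by case: (n) n1 => [|[]] | exact: oner_neq0 |].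
  move=> j j0; rewrite /Z_coef; case: n n1 an0 a_lt a_gt {n0 an nmin} => // n n1 an0 a_lt a_gt /=.
  case: (ltngtP j n) => [jn|nj|->]; rewrite ?mulr1 ?mulr0.
  - by rewrite a_lt // j0 ltnS ltnW.
  - by move: nj; rewrite leq_eqVlt => /orP[/eqP <-|/a_gt].
  - by rewrite a_lt // ltnSn andbT.
exists n, (a n / a 1%N); split=> // [|j j0]; first by rewrite mulf_neq0 ?invr_neq0.
rewrite /Z_coef; case: (ltngtP j n) => [jn|/a_gt ->|->]; rewrite ?mulr1 ?mulr0 //.
  by rewrite a_lt ?j0.
by rewrite mulrC divfK.
Qed.

End Classification.

Theorem theorem20 (K : fieldType) (charK : [pchar K] =i pred0)
    (t : nat -> HCK K) :
  is_strong_order 0 t <->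
  exists c : K, c != 0 /\
    ((forall k : nat, (0 < k)%N -> t k = c ^+ k.-1 *: ladder K k) \/
     exists (n : nat) (b : K), (0 < n)%N /\ b != 0 /\
       forall k : nat, (0 < k)%N -> t k = c ^+ k.-1 *: Z_ n b k).
Proof.
split=> [tS|[c [c0 [tk|[n [b [n0 [b0 tk]]]]]]]]; last 2 first.
- have [tS tL] := ladder_candidate charK c0 tk.
  by apply: strong_order_candidate tS tL; rewrite mulr1.
- have [tS tL] := Z_candidate charK n0 b0 c0 tk.
  apply: strong_order_candidate tS tL; rewrite mulf_neq0 //.
  exact: Z_coef1_neq0.
(* Rescaling by [c] multiplies the array by [c]; normalising the first value to 1 gives
   [c = a 1]. *)
have [a a1 ta] := strong_order0_zeroth tS; exists (a 1%N); split=> //.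
have [aE|[n [b [n0 b0 aE]]]] := zeroth_order_coefficients tS.1 a1 ta; [left|right].
  (* A candidate with the same array as [t], hence equal to it by uniqueness; the other case is
     alike. *)
  pose t' k := a 1%N ^+ k.-1 *: ladder K k.
  have [tS' tL'] := ladder_candidate charK a1 (t := t') (fun _ _ => erefl).
  move=> k k0; apply: (strong_order0_eq charK _ tS' tL' k0).
  by apply: zeroth_order_ext ta => j j0; rewrite mulr1 aE.
exists n, b; split=> //; split=> // k k0.
pose t' k := a 1%N ^+ k.-1 *: Z_ n b k.
have [tS' tL'] := Z_candidate charK n0 b0 a1 (t := t') (fun _ _ => erefl).
apply: (strong_order0_eq charK _ tS' tL' k0).
exact: zeroth_order_ext aE ta.
Qed.
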